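(* Let $G=(V,E)$ be a finite undirected graph, let $\emptyset\neq V_0\subsetneq V_1\subsetneq\cdots\subsetneq V_k\subsetneq V$ be a chain, let $\mathcal{C}=\{\delta(V_0),\dots,\delta(V_k)\}$, let $x$ be a chain-point for this chain, and let $\lambda=2-\max_{i=0,\dots,k}x(\delta(V_i))$. Then there exist $y\in\mathrm{Sp}_{\mathcal{C}}(G)$ and $x'\in\mathrm{Sp}(G)$ such that $x=\lambda y+(1-\lambda)x'$.
   Context: For $S_1,S_2\subseteq V$, $\delta(S_1,S_2)$ is the set of edges with one end in $S_1$ and the other in $S_2$; $E(S)=\delta(S,S)$; $\delta(S)=\delta(S,V\setminus S)$; $\delta(v)=\delta(\{v\})$. For $F\subseteq E$, $x(F)=\sum_{e\in F}x_e$; edge sets are identified with their incidence vectors. $\mathrm{Sp}(G)=\{x\in\mathbb{R}^E: x\ge 0,\ x(E(U))\le |U|-1 \text{ for all nonempty } U\subseteq V,\ x(E)=|V|-1\}$ is the spanning tree polytope. Set $V_{-1}=\emptyset$, $V_{k+1}=V$, and level sets $L_i=V_i\setminus V_{i-1}$ ($i=0,\dots,k+1$). A vector $x\in\mathbb{R}^E$ is a chain-point for the chain if (i) $x\in\mathrm{Sp}(G)$; (ii) $x(\delta(V_0))=x(\delta(V_k))=1$ and $x(\delta(V_i))<2$ for $i=1,\dots,k-1$; (iii) $\sum_{v\in L_i}x(\delta(v))=2|L_i|$ for $i=1,\dots,k$. A Gao-tree for the chain is a spanning tree of $G$ meeting each cut in $\mathcal{C}$ in exactly one edge; $\mathrm{Sp}_{\mathcal{C}}(G)$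 is the convex hull of the incidence vectors of the Gao-trees. *)

(* Defs.v *)
From HB Require Import structures.
From mathcomp Require Import all_boot all_order all_algebra.
From mathcomp Require Import reals.
Set Implicit Arguments.
Unset Strict Implicit.
Unset Printing Implicit Defensive.
Import Order.TTheory GRing.Theory Num.Theory.
Local Open Scope ring_scope.

(* Finite undirected graphs. Edges form a type of their own, so parallel edges
   are allowed; an edge whose set of ends is a singleton is a loop. Simple
   graphs are the case where [ends] is injective with values of cardinal 2. *)
Record ugraph := UGraph {
  vertex : finType;
  edge : finType;
  ends : edge -> {set vertex};
  ends_card : forall e, (0 < #|ends e| <= 2)%N
}.

Section GraphDefs.
Variable G : ugraph.
Implicit Types (S : {set vertex G}) (T : {set edge G}).

Definition joins (e : edge G) (u v : vertex G) : bool :=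
  ends e == [set u; v].

Definition edges_between S1 S2 : {set edge G} :=
  [set e | [exists u in S1, exists v in S2, joins e u v]].

Definition inner_edges S : {set edge G} := edges_between S S.

Definition cut S : {set edge G} := edges_between S (~: S).

Definition star (v : vertex G) : {set edge G} := cut [set v].

Definition adj T : rel (vertex G) :=
  [rel u v | [exists e in T, joins e u v]].

Definition connected_by T : Prop := forall u v, connect (adj T) u v.

(* The sequence (v_1, e_1), ..., (v_n, e_n) stands for the closed walk
   v_1 e_1 v_2 e_2 ... v_n e_n v_1, with distinct vertices and distinct edges.
   A loop is a circuit with n = 1, two parallel edges one with n = 2. *)
Definition circuit (c : seq (vertex G * edge G)) : bool :=
  [&& c != [::], uniq (unzip1 c), uniq (unzip2 c) &
      cycle [rel p q | joins p.2 p.1 q.1] c].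

Definition acyclic T : Prop :=
  forall c, circuit c -> ~~ all (fun e => e \in T) (unzip2 c).

Definition spanning_tree T : Prop := connected_by T /\ acyclic T.

Variable k : nat.
Implicit Type C : 'I_k.+1 -> {set vertex G}.

Definition is_chain C : Prop :=
  [/\ C ord0 != set0,
      forall i j : 'I_k.+1, (i < j)%N -> C i \proper C j
    & C ord_max \proper [set: vertex G]].

(* L_i = V_i \ V_(i-1), where V_(-1) is empty *)
Definition level C (i : 'I_k.+1) : {set vertex G} :=
  C i :\: (if val i is j.+1 then C (inord j) else set0).

Definition gao_tree C T : Prop :=
  spanning_tree T /\ forall i, #|T :&: cut (C i)| = 1%N.

Variable R : realType.
Implicit Type x : {ffun edge G -> R}.

Definition incidence T : {ffun edge G -> R} := [ffun e => (e \in T)%:R].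

Definition total x (F : {set edge G}) : R := \sum_(e in F) x e.

Definition spanning_tree_polytope x : Prop :=
  [/\ forall e, 0 <= x e,
      forall U : {set vertex G}, U != set0 ->
        total x (inner_edges U) <= #|U|%:R - 1
    & total x [set: edge G] = #|vertex G|%:R - 1].

Definition convex_hull (A : {ffun edge G -> R} -> Prop) x : Prop :=
  exists (n : nat) (w : 'I_n -> R) (p : 'I_n -> {ffun edge G -> R}),
    [/\ forall i, 0 <= w i, \sum_i w i = 1, forall i, A (p i)
      & x = [ffun e => \sum_i w i * p i e]].

Definition gao_polytope C : {ffun edge G -> R} -> Prop :=
  convex_hull (fun z => exists2 T, gao_tree C T & z = incidence T).

Definition chain_point C x : Prop :=
  [/\ spanning_tree_polytope x,
      total x (cut (C ord0)) = 1,
      total x (cut (C ord_max)) = 1,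
      forall i : 'I_k.+1, (1 <= i < k)%N -> total x (cut (C i)) < 2
    & forall i : 'I_k.+1, (1 <= i)%N ->
        \sum_(v in level C i) total x (star v) = 2 * #|level C i|%:R].

(* The base point of the iterated maximum is itself one of the terms. *)
Definition max_cut C x : R :=
  \big[Num.max/total x (cut (C ord0))]_(i < k.+1) total x (cut (C i)).

End GraphDefs.

(* Main.v *)
Require Import Defs.
From mathcomp Require Import all_boot all_order all_algebra.
From mathcomp Require Import reals zify ring lra.
Set Implicit Arguments.
Unset Strict Implicit.
Unset Printing Implicit Defensive.
Import Order.TTheory GRing.Theory Num.Theory.

(** Write [L_0, ..., L_{k+1}] for the levels of the chain. A spanning tree is a
    Gao-tree iff it consists of a spanning tree of each level and of one edge
    between any two consecutive levels, so the Gao-trees are the bases of a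
    graphic matroid [M]: move each edge between consecutive levels to fixed
    representatives of these levels and turn the edges skipping a level into
    loops. Let [r_M] be its rank function and [r] that of the cycle matroid of
    [G]. By the greedy algorithm, which can use the same order of the edges for
    both matroids, and Farkas' lemma, it suffices that
      [x(F) <= lambda r_M(F) + (1 - lambda) r(F)] for all [F].
    Let [gap F] be the difference of the two sides. It does not increase when
    the edges inside [W] are added to [F], where [W] is a level or the union of
    two consecutive ones, two vertices of [W] are connected by [F] but not by
    the edges of [F] inside [W], and the latter all lie inside a level: this
    uses [x(E(W)) >= |W| - 2 + lambda] and submodularity. Once no such addition
    is possible, [gap F] does not increase either when one removes all edges
    crossing a cut [V_i] with two components of [F] in [L_i] reaching above
    [V_i] (they weigh at most [2 - lambda]), or all edges skipping [L_{i+1}]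
    when [F] has no edge between [L_i] and [L_{i+1}] but connects [L_i] to
    higher levels (they weigh at most [1 - lambda]). When no removal applies,
    [r(F) <= r_M(F)], and [gap F >= r(F) - x(F) >= 0]. *)

(** * Rank of a set of pairs of vertices *)

Section GraphicRank.
Variable V : finType.
Implicit Types (P Q : {set V * V}) (a b u v : V).

Definition pair_rel P : rel V :=
  fun a b => ((a, b) \in P) || ((b, a) \in P).

Definition conn P : rel V := connect (pair_rel P).

Definition component P a : {set V} := [set b | conn P a b].

Definition components P : {set {set V}} := [set component P a | a in V].

(** The rank function of the graphic matroid on pairs; [conn] ignores the order inside a pair. *)
Definition rk P : nat := #|V| - #|components P|.

Lemma conn_sym P a b : conn P a b = conn P b a.
Proof. by apply: (@sym_connect_sym _ (pair_rel P)) => c d; apply: orbC. Qed.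

Lemma conn_refl P a : conn P a a.
Proof. exact: connect0. Qed.

Lemma conn_trans P b a c : conn P a b -> conn P b c -> conn P a c.
Proof. exact: connect_trans. Qed.

Lemma conn_mem P a b : (a, b) \in P -> conn P a b.
Proof. by move=> Pab; apply: connect1; rewrite /pair_rel Pab. Qed.

Lemma conn_incl P Q :
  (forall a b, (a, b) \in P -> conn Q a b) ->
  forall a b, conn P a b -> conn Q a b.
Proof.
move=> PQ; apply: connect_sub => a b /orP[/PQ//|/PQ].
by rewrite -/(conn Q a b) conn_sym.
Qed.

Lemma conn_sub P Q a b : P \subset Q -> conn P a b -> conn Q a b.
Proof. by move=> /subsetP PQ; apply: conn_incl => c d /PQ /conn_mem. Qed.

Lemma conn_inv (T : Type) (h : V -> T) P :
  (forall a b, (a, b) \in P -> h a = h b) ->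
  forall a b, conn P a b -> h a = h b.
Proof.
move=> hP a b /connectP[p + ->]; elim: p a => [//|c p IH] a /=.
by case/andP => /orP[/hP->|/hP<-] /IH.
Qed.

Lemma conn_pairU P u v a b :
  conn ((u, v) |: P) a b =
  [|| conn P a b, conn P a u && conn P v b | conn P a v && conn P u b].
Proof.
set Q := _ |: P; have sPQ: P \subset Q by apply: subsetUr.
have Quv: conn Q u v by apply: conn_mem; rewrite !inE eqxx.
apply/idP/or3P => [|[/(conn_sub sPQ)//||]]; last 2 first.
- case/andP=> /(conn_sub sPQ) au /(conn_sub sPQ) vb.
  exact: conn_trans au (conn_trans Quv vb).
- case/andP=> /(conn_sub sPQ) av /(conn_sub sPQ) ub.
  by apply: conn_trans av (conn_trans _ ub); rewrite conn_sym.
move/connectP=> [p + ->] {b}.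
elim: p a => [|c p IH] a /=; first by move=> _; constructor 1; apply: conn_refl.
move=> /andP[ac /IH]; move: (last c p) => b cb.
have: conn P a c \/ (a = u /\ c = v) \/ (a = v /\ c = u).
  case/orP: ac; rewrite !inE => /orP[/eqP[-> ->]|/conn_mem]; auto.
  by rewrite conn_sym; left.
case=> [ac1|[[au cv]|[av cu]]] {ac}; subst.
- case: cb => [cb|/andP[cu vb]|/andP[cv ub]].
  + by constructor 1; apply: conn_trans cb.
  + by constructor 2; rewrite vb (conn_trans ac1 cu).
  + by constructor 3; rewrite ub (conn_trans ac1 cv).
- case: cb => [cb|/andP[cu vb]|/andP[cv ub]].
  + by constructor 2; rewrite conn_refl.
  + by constructor 2; rewrite conn_refl.
  + by constructor 1.
- case: cb => [cb|/andP[cu vb]|/andP[cv ub]].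
  + by constructor 3; rewrite conn_refl.
  + by constructor 1.
  + by constructor 3; rewrite conn_refl.
Qed.

Lemma component_eq P a b : (component P a == component P b) = conn P a b.
Proof.
apply/eqP/idP => [/setP/(_ b)|ab]; first by rewrite !inE conn_refl.
apply/setP => c; rewrite !inE; apply/idP/idP; last exact: conn_trans.
by apply: conn_trans; rewrite conn_sym.
Qed.

Lemma card_components P : #|components P| <= #|V|.
Proof. exact: leq_imset_card. Qed.

Lemma sum_card_components P : \sum_(U in components P) #|U| = #|V|.
Proof.
rewrite -sum1_card (partition_big_imset (component P)) /=.
apply: eq_bigr => U /imsetP[a _ ->]; rewrite -sum1_card.
by apply: eq_bigl => b; rewrite inE component_eq conn_sym.
Qed.

Lemma eq_conn_rk P Q : conn P =2 conn Q -> rk P = rk Q.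
Proof.
move=> PQ; rewrite /rk; congr (_ - #|pred_of_set _|).
by apply: eq_imset => a; apply/setP => b; rewrite !inE PQ.
Qed.

(** The new pair merges the components [Cu] and [Cv] and leaves all others unchanged. *)
Lemma card_components_pairU P u v :
  ~~ conn P u v -> #|components P| = #|components ((u, v) |: P)|.+1.
Proof.
move=> nuv; set Cu := component P u; set Cv := component P v.
have Nuv : Cv \in components P :\ Cu.
  by rewrite !inE component_eq conn_sym nuv imset_f.
rewrite (cardsD1 Cu) (cardsD1 Cv (_ :\ _)) Nuv imset_f // !add1n.
suff -> : components ((u, v) |: P) = (Cu :|: Cv) |: (components P :\ Cu :\ Cv).
  rewrite cardsU1; case: (boolP (_ \in _)) => //=.
  rewrite !inE => /and3P[_ /eqP + /imsetP[a _ E]].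
  have := in_setU u Cu Cv; rewrite E !inE conn_refl /= => ua [].
  by apply/eqP; rewrite component_eq.
have componentE a : component ((u, v) |: P) a =
    if conn P a u || conn P a v then Cu :|: Cv else component P a.
  apply/setP => b; rewrite !inE conn_pairU.
  case: (boolP (conn P a u)) => au /=.
    have eqa c : conn P a c = conn P u c.
      by apply/idP/idP; apply: conn_trans; rewrite // conn_sym.
    by rewrite !eqa (negPf nuv) orbF !inE.
  case: (boolP (conn P a v)) => av; rewrite ?inE ?orbF //=.
  have eqa c : conn P a c = conn P v c.
    by apply/idP/idP; apply: conn_trans; rewrite // conn_sym.
  by rewrite eqa orbC.
apply/setP => U; rewrite !inE; apply/imsetP/idP => [[a _ ->]|].
  rewrite componentE; case: ifP => [|/negbT]; first by rewrite eqxx.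
  by rewrite negb_or => /andP[au av]; rewrite !component_eq au av imset_f // orbT.
case/orP => [/eqP->|/and3P[Uv Uu /imsetP[a _ E]]].
  by exists u => //; rewrite componentE conn_refl.
exists a => //; rewrite componentE E.
by rewrite E !component_eq in Uu Uv; rewrite (negPf Uu) (negPf Uv).
Qed.

Lemma rk_pairU P u v : rk ((u, v) |: P) = rk P + ~~ conn P u v.
Proof.
case: (boolP (conn P u v)) => uv /=; last first.
  rewrite /rk (card_components_pairU uv).
  by move: (card_components P); rewrite (card_components_pairU uv); lia.
rewrite addn0; apply: eq_conn_rk => a b; rewrite conn_pairU.
apply/or3P/idP => [[//|/andP[au]|/andP[av]]|]; last by constructor 1.
  by apply: conn_trans; apply: conn_trans uv.
by apply: conn_trans; apply: conn_trans av _; rewrite conn_sym.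
Qed.

Lemma rk_set0 : rk set0 = 0.
Proof.
rewrite /rk card_imset ?subnn // => a b /eqP; rewrite component_eq.
by apply: (@conn_inv _ id) => c d; rewrite inE.
Qed.

Lemma pairset_ind (p : {set V * V} -> Prop) :
  p set0 -> (forall u v Q, p Q -> p ((u, v) |: Q)) -> forall Q, p Q.
Proof.
move=> p0 pU Q; elim: {Q}#|Q| {-2}Q (erefl #|Q|) => [|n IH] Q.
  by move/eqP; rewrite cards_eq0 => /eqP->.
case: (set_0Vmem Q) => [->|[[u v] Quv]]; first by rewrite cards0.
rewrite (cardsD1 (u, v)) Quv => -[/IH]; rewrite -{2}(setD1K Quv).
exact: pU.
Qed.

(** Submodularity in the form of diminishing returns. Insert the pairs of [S] one at a time: each
    raises the rank exactly when its ends are not yet connected, and ends not connected over the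
    larger set are not connected over the smaller one. *)
Lemma rk_diminishing P Q S :
  P \subset Q -> rk (S :|: Q) + rk P <= rk Q + rk (S :|: P).
Proof.
move=> PQ; elim/pairset_ind: S => [|u v S IH]; first by rewrite !set0U.
rewrite -!setUA !rk_pairU.
have := @conn_sub (S :|: P) (S :|: Q) u v (setUS _ PQ).
by move: IH; do 2!case: conn => /=; lia.
Qed.

Lemma rk_submod P Q : rk (P :|: Q) + rk (P :&: Q) <= rk P + rk Q.
Proof.
by have := @rk_diminishing (P :&: Q) P Q (subsetIl _ _);
  rewrite setUC (setUidPl (subsetIr P Q)).
Qed.

Lemma rk_sub P Q : P \subset Q -> rk P <= rk Q.
Proof.
move=> PQ; rewrite -(setUidPl PQ); elim/pairset_ind: (Q) => [|u v S].
  by rewrite set0U.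
by rewrite -setUA rk_pairU; lia.
Qed.

Lemma rk_incl P Q : (forall a b, (a, b) \in P -> conn Q a b) -> rk P <= rk Q.
Proof.
move=> PQ; have ->: rk Q = rk (P :|: Q); last exact/rk_sub/subsetUl.
apply: eq_conn_rk => a b; apply/idP/idP; first exact/conn_sub/subsetUr.
by apply: conn_incl => c d; rewrite inE => /orP[/PQ|/conn_mem].
Qed.

Lemma rk_card P : rk P <= #|P|.
Proof.
have [n] := ubnP #|P|; elim: n P => [//|n IH] P.
case: (set_0Vmem P) => [->|[[u v] Puv]]; first by rewrite rk_set0.
rewrite (cardsD1 (u, v)) Puv add1n !ltnS => /IH.
have -> : rk P = rk ((u, v) |: (P :\ (u, v))) by rewrite setD1K.
by rewrite rk_pairU -addn1 => H; apply: leq_add H (leq_b1 _).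
Qed.

Lemma rk_loop P a : (a, a) \in P -> rk P < #|P|.
Proof.
move=> Paa; rewrite (cardsD1 (a, a)) Paa ltnS.
by rewrite -(setD1K Paa) rk_pairU conn_refl setD1K // addn0 rk_card.
Qed.

(** The star centred at any [w] in [W] connects all of [W] with [#|W| - 1] pairs. *)
Lemma rk_box (W : {set V}) : W != set0 -> rk (setX W W) < #|W|.
Proof.
case/set0Pn=> w Ww; pose S := [set (w, z) | z in W :\ w].
have conn_w z : z \in W -> conn S w z.
  case: (eqVneq z w) => [-> _|zw Wz]; first exact: conn_refl.
  by apply: conn_mem; apply: imset_f; rewrite !inE zw.
rewrite (cardsD1 w) Ww ltnS; apply: (@leq_trans (rk S)).
  apply: rk_incl => a b; rewrite inE => /andP[/conn_w wa /conn_w].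
  by apply: conn_trans; rewrite conn_sym.
exact: leq_trans (rk_card _) (leq_imset_card _ _).
Qed.

Lemma rk_ltV P : 0 < #|V| -> rk P < #|V|.
Proof.
move=> V0; have: rk P <= rk (setX setT setT).
  by apply: rk_sub; apply/subsetP => -[a b]; rewrite !inE.
move/leq_ltn_trans; apply; rewrite -[ltnRHS]cardsT; apply: rk_box.
by rewrite -card_gt0 cardsT.
Qed.

Lemma rk_conn P a b : #|V|.-1 <= rk P -> conn P a b.
Proof.
rewrite -component_eq => H; apply: contraT => nab.
have: #|[set component P a; component P b]| <= #|components P|.
  by apply/subset_leq_card/subsetP => U; rewrite !inE => /orP[]/eqP->;
    apply: imset_f.
move: H (card_components P); rewrite cards2 nab /= /rk.
by move: #|V| #|components P| => n m; lia.
Qed.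

(** The pair [(p i, q i)] is the only one that passes from levels at most [i] to higher levels, so
    it always raises the rank by one. *)
Lemma rk_ladder (lev : V -> nat) (p q : nat -> V) P (J : seq nat) :
  (forall a b, (a, b) \in P -> lev a = lev b) ->
  (forall i, i \in J -> lev (p i) = i) ->
  (forall i, i \in J -> lev (q i) = i.+1) -> uniq J ->
  rk (P :|: [set:: [seq (p i, q i) | i <- J]]) = rk P + size J.
Proof.
move=> levP; elim: J => [|i J IH] levp levq /=.
  move=> _; rewrite addn0; congr rk; apply/setP => z.
  by rewrite !inE orbF.
case/andP=> iJ uJ; set S := _ :|: _.
set S1 := P :|: [set:: [seq (p i, q i) | i <- J]].
have -> : S = (p i, q i) |: S1.
  by apply/setP => z; rewrite !inE orbCA.
have Ji j : j \in J -> j \in i :: J by move=> Jj; rewrite inE Jj orbT.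
rewrite rk_pairU IH //; [|by move=> j /Ji/levp|by move=> j /Ji/levq].
suff -> : ~~ conn S1 (p i) (q i) by rewrite /=; lia.
have h a b : (a, b) \in S1 -> (lev a <= i) = (lev b <= i).
  rewrite !inE => /orP[/levP->//|/mapP[j Jj [-> ->]]].
  have ji : j != i by apply: contraNneq iJ => <-.
  by rewrite levp ?levq ?Ji //; lia.
apply/negP => /(conn_inv h); rewrite levp ?levq ?inE ?eqxx //.
by lia.
Qed.

End GraphicRank.

Local Open Scope ring_scope.

(** * Farkas' lemma and greedy bases *)

Section Farkas.
Variables (R : realFieldType) (E : finType).
Implicit Types (a b w : {ffun E -> R}) (s : seq {ffun E -> R}).

Definition dot w a : R := \sum_e w e * a e.

Lemma dotBr w a b (t : R) :
  dot w [ffun e => a e - t * b e] = dot w a - t * dot w b.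
Proof.
rewrite /dot mulr_sumr -sumrB; apply: eq_bigr => e _.
by rewrite ffunE mulrBr mulrCA.
Qed.

Lemma dotC w a : dot w a = dot a w.
Proof. by apply: eq_bigr => e _; rewrite mulrC. Qed.

(* When the separator [w] found for the tail [s] fails on the new generator [a],
   project along [a] onto the hyperplane [w^\perp] and recurse. *)
Lemma farkas s b :
  (exists2 c : nat -> R, forall i, 0 <= c i &
     forall e, b e = \sum_(i < size s) c i * nth [ffun=> 0] s i e) \/
  (exists2 w, forall a, a \in s -> dot w a <= 0 & 0 < dot w b).
Proof.
have [n] : exists n, size s = n by exists (size s).
elim: n s b => [|n IH] [|a s] b //= => [_|[sz]].
  have [->|/eqP b0] := eqVneq b [ffun=> 0].
    by left; exists (fun=> 0) => // e; rewrite big_ord0 ffunE.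
  right; exists b => //; rewrite lt_neqAle eq_sym.
  rewrite psumr_neq0 ?sumr_ge0 => [|e _|e _]; rewrite -?expr2 ?sqr_ge0 //.
  rewrite andbT; apply: contraT => /hasPn b1; case: b0; apply/ffunP => e.
  have := b1 e; rewrite mem_index_enum -expr2 -leNgt => /(_ isT) b2.
  by rewrite ffunE; apply/eqP; rewrite -sqrf_eq0 eq_le b2 sqr_ge0.
case: (IH s b sz) => [[c c0 bE]|[w ws wb]].
  left; exists (fun i => if i is j.+1 then c j else 0) => [[]//|e].
  by rewrite sz big_ord_recl mul0r add0r bE sz.
have [wa|wa] := leP (dot w a) 0.
  by right; exists w => // a'; rewrite inE => /orP[/eqP->|/ws].
have wa0 : dot w a != 0 by rewrite gt_eqF.
pose pr (z : {ffun E -> R}) : {ffun E -> R} :=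
  [ffun e => z e - dot w z / dot w a * a e].
case: (IH (map pr s) (pr b)); first by rewrite size_map.
- case=> c c0 bE; left.
  pose g := \sum_(i < n) c i * dot w (nth [ffun=> 0] s i).
  have g0 : g <= 0.
    apply: sumr_le0 => i _; rewrite mulr_ge0_le0 // ws // mem_nth //.
    by rewrite sz ltn_ord.
  (* Undoing the projection in the combination found for [pr b] leaves this coefficient for [a]; it
     is nonnegative because [g <= 0 < dot w b]. *)
  exists (fun i => if i is j.+1 then c j else (dot w b - g) / dot w a).
    by case=> // ; rewrite divr_ge0 ?subr_ge0 ?(ltW wa) // (le_trans g0) // ltW.
  move=> e; rewrite sz big_ord_recl /=.
  have := bE e; rewrite size_map sz ffunE => /eqP; rewrite subr_eq => /eqP->.
  rewrite [X in X + _](_ : _ = \sum_(i < n) c i * nth [ffun=> 0] s i e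
      - g / dot w a * a e); first by field.
  rewrite -[g / _ * _]mulrA mulr_suml -sumrB; apply: eq_bigr => i _.
  by rewrite (nth_map [ffun=> 0]) ?sz ?ltn_ord // ffunE; field.
case=> v vs vb; right.
(* The vector [v - t w] is the image of [v] under the transpose of [pr]: its product with any [z] is
   that of [v] with [pr z]. In particular it vanishes on [a]. *)
pose t := dot v a / dot w a.
have swap (p q r : R) : p / q * r = r / q * p.
  by rewrite mulrAC [p * r]mulrC mulrAC.
exists [ffun e => v e - t * w e] => [z|]; last first.
  rewrite dotC dotBr ![dot b _]dotC; move: vb; rewrite dotBr /t.
  by rewrite swap.
rewrite inE => /orP[/eqP->|sz'].
  by rewrite dotC dotBr ![dot a _]dotC divfK // subrr.
have := vs _ (map_f pr sz'); rewrite dotBr => vz.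
rewrite dotC dotBr ![dot z _]dotC /t.
by rewrite -swap.
Qed.

End Farkas.

Section Greedy.
Variables (V E : finType) (phi : E -> V * V).

(** The list is scanned from its end, and an edge is kept when its ends are not yet connected. The
    last clause says that [T] contains a basis of every suffix; for a list sorted by increasing
    weight this makes [T] a basis of maximum weight. *)
Lemma greedy_basis (l : seq E) : uniq l ->
  exists T : {set E},
    [/\ T \subset l, rk (phi @: T) = #|T|,
        conn (phi @: T) =2 conn (phi @: [set:: l])
      & forall m, count [in T] (drop m l) = rk (phi @: [set:: drop m l])].
Proof.
elim: l => [_|e l IH /= /andP[el /IH[T [Tl rT cT sufT]]]].
  exists set0; split=> [|||m]; first by apply/subsetP => z; rewrite inE.
  - by rewrite imset0 rk_set0 cards0.
  - move=> a b; have -> // : [set:: [::]] = set0 :> {set E}.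
    by apply/setP => e; rewrite !inE.
  - have -> : [set:: drop m [::]] = set0 :> {set E}.
      by apply/setP => e; rewrite !inE.
    by rewrite imset0 rk_set0.
have lE : phi @: [set:: e :: l] = phi e |: phi @: [set:: l].
  rewrite -imsetU1; have -> // : [set:: e :: l] = e |: [set:: l].
  by apply/setP => z; rewrite !inE.
have connU P Q : conn P =2 conn Q -> conn (phi e |: P) =2 conn (phi e |: Q).
  by case: (phi e) => u v PQ a b; rewrite !conn_pairU !PQ.
have [cl|ncl] := boolP (conn (phi @: [set:: l]) (phi e).1 (phi e).2).
  have cl' : conn (phi e |: phi @: T) =2 conn (phi @: T).
    move=> a b; apply/idP/idP; last exact/conn_sub/subsetUr.
    apply: conn_incl => c d; rewrite inE in_set1 => /orP[/eqP E1|/conn_mem//].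
    by rewrite cT; move: cl; rewrite -E1.
  have cT' : conn (phi @: T) =2 conn (phi @: [set:: e :: l]).
    by move=> a b; rewrite lE -(connU _ _ cT) cl'.
  exists T; split=> // [|[|m]]; last exact: sufT.
    by apply: subset_trans Tl _; apply/subsetP => z zl; rewrite inE zl orbT.
  rewrite drop0 -(eq_conn_rk cT') rT.
  have := sufT 0%N; rewrite drop0 -(eq_conn_rk cT) rT /= => ->.
  by case: (boolP (e \in T)) => // /(subsetP Tl); rewrite (negPf el).
have eT : e \notin T by apply: contra el => /(subsetP Tl).
have rU P : conn P =2 conn (phi @: [set:: l]) -> rk (phi e |: P) = (rk P).+1.
  move: ncl; case: (phi e) => u v nuv PQ.
  by rewrite rk_pairU PQ nuv addn1.
have cntE m : count [in e |: T] (drop m l) = count [in T] (drop m l).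
  apply: eq_in_count => z /mem_drop zl; rewrite !inE.
  by case: eqP => // ze; move: el; rewrite -ze zl.
exists (e |: T); split=> [|||[|m]].
- apply/subsetP => z; rewrite !inE => /orP[->//|/(subsetP Tl) zl].
  by rewrite zl orbT.
- by rewrite imsetU1 rU // rT cardsU1 eT.
- by move=> a b; rewrite imsetU1 lE; apply: connU.
- rewrite drop0 /= inE in_set1 eqxx lE rU // add1n -(drop0 l) cntE.
  by rewrite sufT.
- by rewrite /= cntE sufT.
Qed.

End Greedy.

(** Abel summation: the sum is the first weight times the total of [d], plus the increments of [w]
    times suffix sums of [d]. The induction proves that the sum is at least the first term, which
    needs no assumption on the total. *)
Lemma abel_sorted (R : realFieldType) (E : eqType) (w d : E -> R) (l : seq E) :
  sorted [rel e f | w e <= w f] l ->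
  (forall m, 0 <= \sum_(e <- drop m l) d e) ->
  \sum_(e <- l) d e = 0 -> 0 <= \sum_(e <- l) w e * d e.
Proof.
case: l => [|e l]; first by move=> *; rewrite !big_nil.
move=> sl dl d0; rewrite -[leLHS](mulr0 (w e)) -[in leLHS]d0 {d0}.
elim: l e sl dl => [|f l IH] e /=; first by move=> *; rewrite !big_seq1.
case/andP=> wef sl dl; rewrite big_cons [leRHS]big_cons mulrDr lerD2l.
apply: le_trans (IH f sl _); last by move=> m; have := dl m.+1.
by rewrite ler_wpM2r //; have := dl 1%N.
Qed.

(** * Graphs with levels *)

Ltac gen_rk := repeat match goal with |- context [rk ?P] => move: (rk P) => ? end.

Section LevelledGraph.
Variables (R : realFieldType) (V E : finType).
(** Each edge is directed upwards from [s e] to [t e]; [K] is the index of the top level, [k.+1] for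
    the chain. *)
Variables (lev : V -> nat) (K : nat) (s t : E -> V) (rep : nat -> V).
Hypothesis lev_max : forall v, (lev v <= K)%N.
Hypothesis lev_st : forall e, (lev (s e) <= lev (t e))%N.
Hypothesis lev_rep : forall i, (i <= K)%N -> lev (rep i) = i.
Implicit Types (e : E) (F T X : {set E}) (u v a b : V) (i j : nat).

Definition mass (x : E -> R) F : R := \sum_(e in F) x e.

Definition st_pair e : V * V := (s e, t e).

(* Bases of the graphic matroid of these pairs are the Gao-trees: edges joining
   consecutive levels become parallel, edges skipping a level become loops. *)
Definition ladder_pair e : V * V :=
  if lev (s e) == lev (t e) then (s e, t e)
  else if lev (t e) == (lev (s e)).+1 then (rep (lev (s e)), rep (lev (t e)))
  else (rep 0, rep 0).

Definition rk_graph F : nat := rk (st_pair @: F).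

Definition rk_ladder_graph F : nat := rk (ladder_pair @: F).

Definition flat F : {set E} := [set e in F | lev (s e) == lev (t e)].

Definition step F i : {set E} :=
  [set e in F | (lev (s e) == i) && (lev (t e) == i.+1)].

Definition band i j : {set V} := [set v | i <= lev v <= j]%N.

Definition band_edges i j : {set E} :=
  [set e | (i <= lev (s e)) && (lev (t e) <= j)]%N.

Lemma st_pairP F a b :
  reflect (exists2 e, e \in F & a = s e /\ b = t e) ((a, b) \in st_pair @: F).
Proof.
apply: (iffP imsetP) => [[e Fe [-> ->]]|[e Fe [-> ->]]]; by exists e.
Qed.

Lemma conn_edge F e : e \in F -> conn (st_pair @: F) (s e) (t e).
Proof. by move=> Fe; apply: conn_mem; apply/st_pairP; exists e. Qed.

Lemma st_pair_inv (A : Type) (h : V -> A) F :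
  (forall e, e \in F -> h (s e) = h (t e)) ->
  forall a b, conn (st_pair @: F) a b -> h a = h b.
Proof.
by move=> hF; apply: conn_inv => a b /st_pairP[e /hF + [-> ->]].
Qed.

Lemma ladder_pair_flat F : ladder_pair @: flat F = st_pair @: flat F.
Proof.
by apply: eq_in_imset => e; rewrite inE /ladder_pair => /andP[_ ->].
Qed.

Lemma flat_sub F : flat F \subset F.
Proof. by apply/subsetP => e; rewrite inE => /andP[]. Qed.

Lemma flat_lev F a b : conn (st_pair @: flat F) a b -> lev a = lev b.
Proof.
by apply: st_pair_inv => e; rewrite inE => /andP[_ /eqP].
Qed.

Lemma ladder_pair_inv F i :
  (forall e, e \in F -> ~~ (lev (s e) <= i < lev (t e))%N) ->
  forall a b, conn (ladder_pair @: F) a b -> (lev a <= i)%N = (lev b <= i)%N.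
Proof.
move=> Fi; apply: conn_inv => a b /imsetP[e /Fi].
have := lev_st e; have := lev_max (t e); rewrite /ladder_pair.
case: eqP => [h _ _ _ [-> ->]|_]; first by rewrite h.
case: eqP => [_ h1 h2 h3 [-> ->]|_ _ _ _ [-> ->//]].
by rewrite !lev_rep //; lia.
Qed.

Lemma ladder_pair_step e :
  lev (t e) = (lev (s e)).+1 ->
  ladder_pair e = (rep (lev (s e)), rep (lev (s e)).+1).
Proof. by move=> H; rewrite /ladder_pair H eqxx ltn_eqF. Qed.

Lemma step_lt F i : step F i != set0 -> (i < K)%N.
Proof.
by case/set0Pn=> e; rewrite inE => /and3P[_ _ /eqP <-]; apply: lev_max.
Qed.

(** One edge of each step is singled out, since all edges of a step are parallel in [M]. The default
    [rep 0] only occurs for an empty step. *)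
Definition step_src F i : V :=
  if [pick e in step F i] is Some e then s e else rep 0.

Definition step_dst F i : V :=
  if [pick e in step F i] is Some e then t e else rep 0.

Lemma stepP F i : step F i != set0 ->
  exists2 e, e \in F & [/\ step_src F i = s e, step_dst F i = t e,
                          lev (s e) = i & lev (t e) = i.+1].
Proof.
rewrite /step_src /step_dst; case: pickP => [e|F0 /set0Pn[e]]; last by rewrite F0.
by rewrite inE => /and3P[Fe /eqP <- /eqP <-] _; exists e.
Qed.

Definition steps_of F (J : seq nat) : {set V * V} :=
  [set:: [seq (step_src F i, step_dst F i) | i <- J]].

Lemma rk_flat_steps F (J : seq nat) :
  uniq J -> {in J, forall i, step F i != set0} ->
  rk (st_pair @: flat F :|: steps_of F J) = (rk_graph (flat F) + size J)%N.
Proof.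
move=> uJ JF; apply: (@rk_ladder _ lev) => // [a b|i /JF|i /JF].
- by move=> /conn_mem/flat_lev.
- by move=> /stepP[e _ [-> _ -> _]].
- by move=> /stepP[e _ [_ -> _ ->]].
Qed.

Lemma rk_flat_steps_graph F (J : seq nat) :
  uniq J -> {in J, forall i, step F i != set0} ->
  (rk_graph (flat F) + size J <= rk_graph F)%N.
Proof.
move=> uJ JF; rewrite -rk_flat_steps //; apply: rk_sub; rewrite subUset.
rewrite imsetS ?flat_sub //=; apply/subsetP => z; rewrite inE.
case/mapP=> i /JF/stepP[e Fe [-> -> _ _]] ->.
by apply/imsetP; exists e.
Qed.

Lemma rk_flat_reps F (J : seq nat) :
  uniq J -> {in J, forall i, (i < K)%N} ->
  rk (st_pair @: flat F :|: [set:: [seq (rep i, rep i.+1) | i <- J]]) =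
  (rk_graph (flat F) + size J)%N.
Proof.
move=> uJ JK.
apply: (@rk_ladder _ lev _ (fun i => rep i.+1)) => // [a b|i /JK|i /JK].
- by move=> /conn_mem/flat_lev.
- by move=> iK; rewrite lev_rep // ltnW.
- by move=> iK; rewrite lev_rep.
Qed.

Lemma rk_flat_steps_ladder F (J : seq nat) :
  uniq J -> {in J, forall i, step F i != set0} ->
  (rk_graph (flat F) + size J <= rk_ladder_graph F)%N.
Proof.
move=> uJ JF; rewrite -rk_flat_reps // => [|i /JF/step_lt //].
apply: rk_sub; rewrite subUset -ladder_pair_flat imsetS ?flat_sub //=.
apply/subsetP => z; rewrite inE => /mapP[i /JF/stepP[e Fe [_ _ si ti]] ->].
by apply/imsetP; exists e => //; rewrite ladder_pair_step si.
Qed.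

(** A ladder pair comes from a flat edge, or joins the representatives of two consecutive levels,
    for which there are [K] possibilities, or is a loop. *)
Lemma rk_ladder_graph_le F : (rk_ladder_graph F <= rk_graph (flat F) + K)%N.
Proof.
rewrite -{1}(size_iota 0 K) -rk_flat_reps ?iota_uniq // => [|i]; last first.
  by rewrite mem_iota.
apply: rk_incl => a b /imsetP[e Fe]; have := lev_st e; have := lev_max (t e).
rewrite /ladder_pair; case: eqP => [st _ _ [-> ->]|st ltK lst].
  apply: conn_mem; rewrite inE; apply/orP; left; apply/st_pairP.
  by exists e => //; rewrite inE Fe st eqxx.
case: eqP => [ste [-> ->]|_ [-> ->]]; last exact: conn_refl.
apply: conn_mem; rewrite in_setU; apply/orP; right; rewrite inE.
by apply/mapP; exists (lev (s e)); rewrite ?ste // mem_iota; lia.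
Qed.

(** * Bases of the ladder matroid and of the cycle matroid *)

Hypothesis V_gt1 : (1 < #|V|)%N.

Lemma rk_le_pred (P : {set V * V}) : (rk P <= #|V|.-1)%N.
Proof. by rewrite -ltnS prednK ?rk_ltV // ltnW. Qed.

Definition ladder_tree T : bool :=
  (rk_ladder_graph T == #|V|.-1) && (#|T| == #|V|.-1).

Definition st_tree T : bool :=
  (rk_graph T == #|V|.-1) && (#|T| == #|V|.-1).

(** Without an edge in this step no ladder pair would separate levels at most [i] from the others,
    and [rep i] could not be connected to [rep i.+1]. *)
Lemma ladder_tree_step T i : ladder_tree T -> (i < K)%N -> step T i != set0.
Proof.
case/andP=> /eqP rT _ iK; apply/set0Pn.
have [/existsP[e Te]|/existsPn nT] := boolP [exists e, e \in step T i].
  by exists e.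
have /(rk_conn (rep i) (rep i.+1)) : (#|V|.-1 <= rk_ladder_graph T)%N.
  by rewrite rT.
suff inv a b : (a, b) \in ladder_pair @: T -> (lev a <= i)%N = (lev b <= i)%N.
  by move=> /(conn_inv inv); rewrite !lev_rep //; lia.
case/imsetP=> e Te; rewrite /ladder_pair.
have := nT e; rewrite inE Te; have := lev_max (t e).
case: (eqVneq (lev (s e)) (lev (t e))) => [st _ _ [-> ->]|_]; first by rewrite st.
case: (eqVneq (lev (t e)) (lev (s e)).+1) => [st tK nst [-> ->]|_ _ _ [-> ->//]].
by rewrite !lev_rep; lia.
Qed.

(** An edge skipping a level becomes a loop, and a basis contains no loop. *)
Lemma ladder_tree_short T e :
  ladder_tree T -> e \in T -> (lev (t e) <= (lev (s e)).+1)%N.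
Proof.
case/andP=> /eqP rT /eqP cT Te; rewrite leqNgt; apply/negP => long.
have : (rep 0, rep 0) \in ladder_pair @: T.
  apply/imsetP; exists e => //; rewrite /ladder_pair.
  case: eqP => [st|_]; first by lia.
  by case: eqP => [st|//]; lia.
move/rk_loop; rewrite -/(rk_ladder_graph T) rT -cT.
by rewrite ltnNge leq_imset_card.
Qed.

(** An edge of [T] crossing the cut belongs to step [i], since it skips no level. All edges of this
    step have the same ladder pair, and [ladder_pair] is injective on the independent set [T]. *)
Lemma ladder_tree_cut T i : ladder_tree T -> (i < K)%N ->
  #|[set e in T | (lev (s e) <= i < lev (t e))%N]| = 1%N.
Proof.
move=> okT iK; have short := @ladder_tree_short T _ okT.
have /set0Pn[d] := ladder_tree_step okT iK.
rewrite inE => /and3P[Td /eqP ds /eqP dt].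
apply/eqP/cards1P; exists d; apply/setP => e; rewrite !inE.
apply/andP/eqP => [[Te ie]|->]; last by rewrite Td ds dt leqnn ltnSn.
have := short e Te => se.
have /imset_injP inj : #|ladder_pair @: T| == #|T|.
  rewrite eqn_leq leq_imset_card; case/andP: okT => /eqP rT /eqP ->.
  by rewrite -rT rk_card.
have ste : lev (t e) = (lev (s e)).+1 by lia.
have std : lev (t d) = (lev (s d)).+1 by rewrite dt ds.
have sed : lev (s e) = lev (s d) by lia.
by apply: inj => //; rewrite !ladder_pair_step // sed.
Qed.

(** As [T] meets all [K] steps, its flat edges and one edge per step already have rank at least
    [rk_ladder_graph T]. *)
Lemma ladder_tree_st T : ladder_tree T -> st_tree T.
Proof.
move=> okT; case/andP: (okT) => /eqP rT cT; apply/andP; split=> //.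
rewrite eqn_leq rk_le_pred -rT /=; apply: leq_trans (rk_ladder_graph_le T) _.
rewrite -[X in (_ + X)%N](size_iota 0 K).
apply: rk_flat_steps_graph; rewrite ?iota_uniq // => i.
by rewrite mem_iota => /andP[_ /(ladder_tree_step okT)].
Qed.

(** * Nonnegativity of the gap, and the decomposition it yields *)

Section Decrease.
Variables (x : E -> R) (lam : R).
Hypothesis x_ge0 : forall e, 0 <= x e.
Hypotheses (lam_gt0 : 0 < lam) (lam_le1 : lam <= 1).
Hypothesis mass_rk : forall F, mass x F <= (rk_graph F)%:R.
Hypothesis mass_band : forall i j, (i <= j <= i.+1)%N -> (j <= K)%N ->
  #|band i j|%:R - 2 + lam <= mass x (band_edges i j).
Hypothesis mass_cross : forall i, (i < K)%N ->
  mass x [set e | (lev (s e) <= i < lev (t e))%N] <= 2 - lam.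
Hypothesis mass_long : forall i, (i < K)%N ->
  mass x [set e | (lev (s e) <= i)%N && (i.+1 < lev (t e))%N] <= 1 - lam.

Definition gap F : R :=
  lam * (rk_ladder_graph F)%:R + (1 - lam) * (rk_graph F)%:R - mass x F.

Lemma mass_sub F X : F \subset X -> mass x F <= mass x X.
Proof.
move=> FX; rewrite /mass [leRHS](big_setID F) /= (setIidPr FX) lerDl.
by apply: sumr_ge0.
Qed.

Lemma massUI F X : mass x (F :|: X) = mass x F + mass x X - mass x (F :&: X).
Proof.
rewrite /mass (big_setID F) /= setUK setDUl setDv set0U.
by rewrite [\sum_(e in X) _](big_setID F) /= setIC; lra.
Qed.

Lemma massD F X : mass x (F :\: X) = mass x F - mass x (F :&: X).
Proof. by rewrite /mass [\sum_(e in F) _](big_setID X) /=; lra. Qed.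

(** With [lev v = lev u] this concerns a single level, where the third clause is automatic; with
    [lev v = (lev u).+1] it concerns two consecutive levels. *)
Definition defect F u v : bool :=
  [&& (lev u <= lev v <= (lev u).+1)%N, conn (st_pair @: F) u v,
      [forall e in F :&: band_edges (lev u) (lev v), lev (s e) == lev (t e)]
    & ~~ conn (st_pair @: (F :&: band_edges (lev u) (lev v))) u v].

(** Put [Y = F :&: X] and [n = #|W|]. Submodularity against [setX W W], of rank at most [n - 1],
    shows that [r_M] grows by at most [n - 1 - r(Y)] and [r] by at most [n - 2 - r(Y)]. The weighted
    mean of these bounds is [n - 2 + lam - r(Y)], which is at most the growth [x(X) - x(Y)] of the
    mass. The second conclusion makes the iteration terminate. *)
Lemma augment F u v : defect F u v ->
  let X := band_edges (lev u) (lev v) in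
  gap (F :|: X) <= gap F /\ ~~ (X \subset F).
Proof.
case/and4P=> uv Fuv /forall_inP flatFX nuv X; set W := band (lev u) (lev v).
have Wu : u \in W by rewrite inE; lia.
have Wv : v \in W by rewrite inE; lia.
have [n nE rW] : exists2 n, n = #|W| & (rk (setX W W) < n)%N.
  by exists #|W| => //; apply: rk_box; apply/set0Pn; exists u.
have XW e : e \in X -> st_pair e \in setX W W.
  by rewrite !inE /=; have := lev_st e; lia.
have XW' e : e \in X -> ladder_pair e \in setX W W.
  move=> Xe; have := XW e Xe; rewrite /ladder_pair /st_pair; case: eqP => // ne _.
  have := lev_st e; have := lev_max v; move: Xe; rewrite inE => ? ? ?.
  case: eqP => ?; last lia.
  by rewrite !inE /= !lev_rep //; lia.
have mX : n%:R - 2 + lam <= mass x X by rewrite nE; apply: mass_band.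
have sU (p : E -> V * V) : (forall e, e \in X -> p e \in setX W W) ->
    p @: (F :|: X) \subset p @: F :|: setX W W.
  move=> pX; apply/subsetP => z /imsetP[e + ->].
  by rewrite !in_setU => /orP[Fe|/pX->]; rewrite ?orbT // imset_f.
pose Y := F :&: X; have mY := mass_rk Y.
have rM : (rk_ladder_graph (F :|: X) + rk_graph Y < rk_ladder_graph F + n)%N.
  have := rk_submod (ladder_pair @: F) (setX W W).
  have := rk_sub (sU _ XW').
  suff: (rk_graph Y <= rk (ladder_pair @: F :&: setX W W))%N.
    by rewrite /rk_ladder_graph /rk_graph; move: rW; gen_rk; lia.
  apply/rk_sub/subsetP => z /imsetP[e Ye ->]; move: (Ye); rewrite inE.
  case/andP=> Fe Xe; rewrite inE XW // andbT.
  have -> : st_pair e = ladder_pair e by rewrite /ladder_pair flatFX.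
  exact: imset_f.
(* Adding the pair [(u, v)] to [F] leaves its rank unchanged, but raises the rank of the part inside
   [W]; this gains one unit over [rM]. *)
have rG : (rk_graph (F :|: X) + (rk_graph Y).+1 < rk_graph F + n)%N.
  have := rk_submod ((u, v) |: st_pair @: F) (setX W W).
  rewrite rk_pairU Fuv addn0.
  have : (rk_graph (F :|: X) <= rk (((u, v) |: st_pair @: F) :|: setX W W))%N.
    rewrite -setUA; apply/rk_sub/(subset_trans (sU _ XW))/subsetUr.
  suff: ((rk_graph Y).+1 <= rk (((u, v) |: st_pair @: F) :&: setX W W))%N.
    by rewrite /rk_graph; move: rW; gen_rk; lia.
  have <- : rk ((u, v) |: st_pair @: Y) = (rk_graph Y).+1.
    by rewrite rk_pairU nuv addn1.
  apply/rk_sub/subsetP => z; rewrite in_setU in_set1 => /orP[/eqP->|].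
    by rewrite in_setI in_setU in_set1 eqxx in_setX Wu Wv.
  case/imsetP=> e; rewrite inE => /andP[Fe /XW We] ->.
  by rewrite in_setI We andbT in_setU imset_f // orbT.
have mU : mass x (F :|: X) = mass x F + mass x X - mass x Y by apply: massUI.
(* If [X] were contained in [F], then [Y = X] would not connect [u] to [v], so that [r(X) <= n - 2],
   against [mass x X >= n - 2 + lam]. *)
have nX : X \subset F -> False.
  move=> /setIidPr XF; move: rG; rewrite /Y XF => rG.
  have : (rk ((u, v) |: st_pair @: X) <= rk (setX W W))%N.
    apply/rk_sub/subsetP => z; rewrite in_setU in_set1 => /orP[/eqP->|].
      by rewrite in_setX Wu Wv.
    by case/imsetP=> e /XW + ->.
  have nuvX : ~~ conn (st_pair @: X) u v by rewrite -XF.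
  rewrite rk_pairU nuvX addn1 => rX.
  have : (rk_graph X + 2 <= n)%N by move: rW rX; rewrite /rk_graph; gen_rk; lia.
  rewrite -(ler_nat R) natrD => H; have := mass_rk X; have := mX.
  by move: lam_gt0 H; lra.
split; last exact/negP.
rewrite /gap mU.
have : (rk_ladder_graph (F :|: X) + rk_graph Y + 1 <= rk_ladder_graph F + n)%N.
  by rewrite addn1.
have : (rk_graph (F :|: X) + rk_graph Y + 2 <= rk_graph F + n)%N.
  by move: rG; lia.
rewrite -!(ler_nat R) !natrD.
have lam1 : 0 <= 1 - lam by rewrite subr_ge0.
move=> /(ler_wpM2l lam1) rG' /(ler_wpM2l (ltW lam_gt0)) rM'.
by move: mX mY rG' rM'; lra.
Qed.

(** These consequences of the absence of defects, unlike that absence itself, are what the later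
    removals are shown to preserve. *)
Definition settled F : Prop :=
  (forall u v, lev u = lev v -> conn (st_pair @: F) u v ->
     conn (st_pair @: flat F) u v) /\
  (forall u v, lev v = (lev u).+1 -> conn (st_pair @: F) u v ->
     step F (lev u) != set0).

(** Induction on the complement of [F], which every augmentation makes strictly smaller. *)
Lemma settle F : exists2 F', gap F' <= gap F & settled F'.
Proof.
have [n] := ubnP #|~: F|; elim: n F => [//|n IH] F.
rewrite ltnS => Fn.
have [/existsP[u /existsP[v /[dup] d /augment[le_gap nXF]]]|] :=
  boolP [exists u, exists v, defect F u v].
  have [|F' le_gap' F'ok] := IH (F :|: band_edges (lev u) (lev v)).
    apply: leq_trans Fn; apply: proper_card; rewrite properE setCS subsetUl.
    by rewrite setCS subUset subxx.
  by exists F' => //; apply: le_trans le_gap.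
move/existsPn => nodef; exists F => //; split=> u v uv Fuv.
- have /existsPn/(_ v) := nodef u; rewrite /defect uv leqnn leqnSn Fuv /=.
  rewrite negb_and negbK => /orP[/forall_inPn[e]|].
    by rewrite !inE => /and3P[_ le1 le2]; have := lev_st e; lia.
  apply: conn_sub; apply: imsetS; apply/subsetP => e; rewrite !inE.
  by case/and3P=> -> le1 le2 /=; have := lev_st e; lia.
(* If the step were empty, the edges of [F] inside the two levels would all be flat. Having no
   defect would then connect [u] to [v] by flat edges, although their levels differ. *)
- apply: contraL Fuv => /eqP st0; apply/negP => Fuv.
  have /existsPn/(_ v) := nodef u; rewrite /defect uv leqnn leqnSn Fuv /=.
  have noflat e : e \in F :&: band_edges (lev u) (lev u).+1 ->
      lev (s e) = lev (t e).
    rewrite !inE => /and3P[Fe le1 le2].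
    have : e \notin step F (lev u) by rewrite st0 inE.
    by rewrite inE Fe; have := lev_st e; lia.
  rewrite negb_and negbK => /orP[/forall_inPn[e /noflat->]|].
    by rewrite eqxx.
  by move/(st_pair_inv noflat); lia.
Qed.

Lemma gap_remove F X (r r' : nat) :
  X \subset F -> (rk_graph (F :\: X) + r <= rk_graph F)%N ->
  (rk_ladder_graph (F :\: X) + r' <= rk_ladder_graph F)%N ->
  mass x X <= lam * r'%:R + (1 - lam) * r%:R -> gap (F :\: X) <= gap F.
Proof.
move=> XF; rewrite -!(ler_nat R) !natrD /gap massD (setIidPr XF).
have lam1 : 0 <= 1 - lam by rewrite subr_ge0.
move=> /(ler_wpM2l lam1) + /(ler_wpM2l (ltW lam_gt0)).
by lra.
Qed.

(** Removing non-flat edges keeps [flat F], and the last hypothesis keeps every step that is still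
    required to be nonempty. *)
Lemma settled_remove F X :
  settled F -> X \subset F -> {in X, forall e, lev (s e) != lev (t e)} ->
  (forall u v, lev v = (lev u).+1 -> conn (st_pair @: (F :\: X)) u v ->
     [disjoint X & step F (lev u)]) ->
  settled (F :\: X).
Proof.
move=> [flatF stepF] XF nX dX.
have sF u v : conn (st_pair @: (F :\: X)) u v -> conn (st_pair @: F) u v.
  by apply/conn_sub/imsetS/subsetDl.
split=> u v uv Fuv.
  have -> : flat (F :\: X) = flat F.
    apply/setP => e; rewrite !inE; have := nX e.
    by case: (e \in X) => //= /(_ isT)/negPf->; rewrite andbF.
  exact: flatF (sF _ _ Fuv).
have /set0Pn[e es] := stepF _ _ uv (sF _ _ Fuv); apply/set0Pn; exists e.
have := dX _ _ uv Fuv; rewrite disjoint_sym => /disjointFr/(_ es) nXe.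
by move: es; rewrite !inE nXe.
Qed.

(** Remove the edges of [F] that skip level [i.+1]. They belong to no step, weigh at most [1 - lam],
    and their removal disconnects [u] from [v], so [r] drops by at least one. *)
Lemma settled_long F u v :
  settled F -> (lev u < lev v)%N -> conn (st_pair @: F) u v ->
  step F (lev u) = set0 ->
  exists F', [/\ F' \proper F, settled F' & gap F' <= gap F].
Proof.
move=> okF uv Fuv st0; set i := lev u.
pose X := [set e in F | (lev (s e) <= i)%N && (i.+1 < lev (t e))%N].
have XF : X \subset F by apply/subsetP => e; rewrite inE => /andP[].
have nuv : ~~ conn (st_pair @: (F :\: X)) u v.
  (* No edge of [F :\: X] leaves the part of the component of [u] at levels at most [i]: its upper
     end would be at level [i.+1] and connected to [u], and [F] being settled would make the step
     nonempty. *)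
  pose h z := conn (st_pair @: F) u z && (lev z <= i)%N.
  suff hF a b : conn (st_pair @: (F :\: X)) a b -> h a = h b.
    apply/negP => /hF; rewrite /h conn_refl Fuv /i leqnn /=.
    by move: uv; lia.
  apply: st_pair_inv => e; rewrite in_setD => /andP[nXe Fe]; rewrite /h.
  have Fst := conn_edge Fe.
  have [us|nus] := boolP (conn (st_pair @: F) u (s e)); last first.
    have [ut|//] := boolP (conn (st_pair @: F) u (t e)).
    by case/negP: nus; apply: conn_trans ut _; rewrite conn_sym.
  have ut := conn_trans us Fst; rewrite ut /=.
  have := lev_st e; move: nXe; rewrite inE Fe /=.
  have [it|] := eqVneq (lev (t e)) i.+1; last by lia.
  by have := okF.2 _ _ it ut; rewrite st0 eqxx.
have iK : (i < K)%N by apply: leq_trans uv (lev_max v).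
exists (F :\: X); split.
- by rewrite properEneq subsetDl andbT; apply: contraNneq nuv => ->.
- apply: settled_remove => // [e|a b _ _]; rewrite ?inE.
    by case/and3P=> _ le1 le2; apply/eqP; lia.
  rewrite -setI_eq0; apply/eqP/setP => e; rewrite !inE.
  case: (e \in F) => //=; apply/negP; lia.
- apply: (@gap_remove _ _ 1 0) => //.
  + rewrite addn1; apply: (@leq_trans (rk ((u, v) |: st_pair @: (F :\: X)))).
      by rewrite rk_pairU nuv addn1.
    apply: rk_incl => a b; rewrite in_setU in_set1 => /orP[/eqP[-> ->]//|ab].
    by apply: conn_sub (conn_mem ab); apply/imsetS/subsetDl.
  + by rewrite addn0; apply/rk_sub/imsetS/subsetDl.
  + rewrite mulr0 add0r mulr1; apply: le_trans (mass_long iK).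
    by apply: mass_sub; apply/subsetP => e; rewrite !inE => /andP[].
Qed.

(** Remove all edges of [F] crossing the cut above level [i]. The components of [u] and [u'] are
    both split, so [r] drops by at least two; the step edge [d] makes [r_M] drop by at least one.
    The removed mass is at most [2 - lam = lam * 1 + (1 - lam) * 2]. *)
Lemma settled_cross F u v u' v' :
  settled F -> lev u' = lev u -> (lev u < lev v)%N -> (lev u < lev v')%N ->
  conn (st_pair @: F) u v -> conn (st_pair @: F) u' v' ->
  ~~ conn (st_pair @: F) u u' -> step F (lev u) != set0 ->
  exists F', [/\ F' \proper F, settled F' & gap F' <= gap F].
Proof.
move=> okF uu' uv uv' Fuv Fuv' nuu' /set0Pn[d dF]; set i := lev u.
pose X := [set e in F | (lev (s e) <= i < lev (t e))%N].
have XF : X \subset F by apply/subsetP => e; rewrite inE => /andP[].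
have nX e : e \in F :\: X -> ~~ (lev (s e) <= i < lev (t e))%N.
  by rewrite !inE => /andP[+ Fe]; rewrite Fe.
have sides a b : conn (st_pair @: (F :\: X)) a b ->
    (lev a <= i)%N = (lev b <= i)%N.
  apply: (@st_pair_inv _ (fun z => (lev z <= i)%N)) => e /nX.
  by have := lev_st e; lia.
have sF a b : conn (st_pair @: (F :\: X)) a b -> conn (st_pair @: F) a b.
  by apply/conn_sub/imsetS/subsetDl.
have nconn a b : (lev a <= i)%N -> (i < lev b)%N ->
    conn (st_pair @: (F :\: X)) a b = false.
  by move=> ai ib; apply/negP => /sides; lia.
have iK : (i < K)%N by apply: leq_trans uv (lev_max v).
have [dF1 ds dt] : [/\ d \in F, lev (s d) = i & lev (t d) = i.+1].
  by move: dF; rewrite inE => /and3P[-> /eqP-> /eqP->].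
have dX : d \in X by rewrite inE dF1 ds dt leqnn ltnSn.
exists (F :\: X); split.
- rewrite properEneq subsetDl andbT; apply/eqP => /setP/(_ d).
  by rewrite in_setD dX dF1.
- apply: settled_remove => // [e|a b ab Fab]; rewrite ?inE.
    by case/and3P=> _ le1 le2; apply/eqP; lia.
  rewrite -setI_eq0; apply/eqP/setP => e; rewrite !inE.
  case: (e \in F) => //=; apply/negP.
  by have := sides _ _ Fab; lia.
- apply: (@gap_remove _ _ 2 1) => //.
  + pose P := (u, v) |: st_pair @: (F :\: X).
    apply: (@leq_trans (rk ((u', v') |: P))).
      have nuu : conn (st_pair @: (F :\: X)) u' u = false.
        by apply: contraNF nuu' => /sF; rewrite conn_sym.
      have nP : ~~ conn P u' v'.
        by rewrite conn_pairU nuu !(nconn u') // uu'.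
      by rewrite !rk_pairU nP nconn // -addnA.
    apply: rk_incl => a b; rewrite !in_setU !in_set1.
    case/or3P=> [/eqP[-> ->]//|/eqP[-> ->]//|ab].
    by apply: sF (conn_mem ab).
  + rewrite addn1.
    apply: (@leq_trans (rk (ladder_pair d |: ladder_pair @: (F :\: X)))).
      rewrite ladder_pair_step ?ds // rk_pairU.
      suff -> : ~~ conn (ladder_pair @: (F :\: X)) (rep i) (rep i.+1).
        by rewrite addn1.
      apply/negP => /(ladder_pair_inv nX).
      by rewrite !lev_rep; lia.
    rewrite -imsetU1; apply/rk_sub/imsetS.
    by rewrite subUset sub1set dF1 subsetDl.
  + apply: le_trans (_ : 2 - lam <= _); last by lra.
    apply: le_trans (mass_cross iK).
    by apply: mass_sub; apply/subsetP => e; rewrite !inE => /andP[].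
Qed.

(** The flat edges and one edge per nonempty step connect all that [F] connects. To climb from [a]
    towards [b], take the chosen edge [e] of the step above [a]: by uniqueness its lower end lies in
    the component of [a], hence is reached by flat edges, and one continues from [t e]. These edges
    have the same rank in [M] as in [G]. *)
Lemma settled_rk F :
  settled F ->
  (forall u v, (lev u < lev v)%N -> conn (st_pair @: F) u v ->
     step F (lev u) != set0) ->
  (forall u v u' v', lev u' = lev u -> (lev u < lev v)%N -> (lev u < lev v')%N ->
     conn (st_pair @: F) u v -> conn (st_pair @: F) u' v' ->
     conn (st_pair @: F) u u') ->
  (rk_graph F <= rk_ladder_graph F)%N.
Proof.
move=> [flatF _] stepF oneF.
pose J := [seq i <- iota 0 K | step F i != set0].
have uJ : uniq J by rewrite filter_uniq ?iota_uniq.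
have JF : {in J, forall i, step F i != set0}.
  by move=> i; rewrite mem_filter => /andP[].
have FJ i : step F i != set0 -> i \in J.
  by move=> Fi; rewrite mem_filter Fi mem_iota add0n /= (step_lt Fi).
apply: leq_trans (rk_flat_steps_ladder uJ JF); rewrite -(rk_flat_steps uJ JF).
set Q := _ :|: _.
have flatQ a b : conn (st_pair @: flat F) a b -> conn Q a b.
  exact/conn_sub/subsetUl.
suff up n a b : lev b = (lev a + n)%N -> conn (st_pair @: F) a b -> conn Q a b.
  apply: rk_incl => a b /imsetP[e Fe [-> ->]].
  by apply: (up (lev (t e) - lev (s e))%N); rewrite ?subnKC ?conn_edge.
elim: n a => [|n IH] a.
  by rewrite addn0 => ab Fab; apply/flatQ/flatF.
move=> ab Fab; have lt_ab : (lev a < lev b)%N by lia.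
have Fa := stepF _ _ lt_ab Fab; have [e Fe [pE qE se te]] := stepP Fa.
have Fst := conn_edge Fe.
have ltst : (lev a < lev (t e))%N by rewrite te.
have Fas := oneF _ _ _ _ se lt_ab ltst Fab Fst.
have Qas : conn Q a (s e) by apply/flatQ/flatF.
have Qst : conn Q (s e) (t e).
  apply: conn_mem; rewrite in_setU; apply/orP; right; rewrite inE.
  by apply/mapP; exists (lev a); rewrite ?FJ // pE qE.
apply: conn_trans Qas (conn_trans Qst _); apply: IH; first by rewrite te; lia.
apply: conn_trans Fab; rewrite conn_sym.
exact: conn_trans Fas Fst.
Qed.

Lemma settled_gap_ge0 F : settled F -> 0 <= gap F.
Proof.
have [n] := ubnP #|F|; elim: n F => [//|n IH] F; rewrite ltnS => Fn okF.
have down : (exists F', [/\ F' \proper F, settled F' & gap F' <= gap F]) ->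
    0 <= gap F.
  case=> F' [pF okF' /(le_trans _)]; apply; apply: IH => //.
  exact: leq_trans (proper_card pF) Fn.
have [/existsP[u /existsP[v /and3P[uv Fuv /eqP su]]]|/existsPn N2] :=
  boolP [exists u, exists v, [&& (lev u < lev v)%N, conn (st_pair @: F) u v
    & step F (lev u) == set0]].
  exact/down/(settled_long okF uv Fuv su).
have stepF u v : (lev u < lev v)%N -> conn (st_pair @: F) u v ->
    step F (lev u) != set0.
  by move=> uv Fuv; have /existsPn/(_ v) := N2 u; rewrite uv Fuv.
have [le_rk|gt_rk] := leqP (rk_graph F) (rk_ladder_graph F).
  rewrite /gap; move: le_rk; rewrite -(ler_nat R) => /(ler_wpM2l (ltW lam_gt0)).
  by have := mass_rk F; lra.
apply: contraT => ngap.
suff: (rk_graph F <= rk_ladder_graph F)%N by rewrite leqNgt gt_rk.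
apply: settled_rk => // u v u' v' uu' uv uv' Fuv Fuv'.
apply: contraT => nuu'; case/negP: ngap.
apply: down; exact: settled_cross uu' uv uv' Fuv Fuv' nuu' (stepF _ _ uv Fuv).
Qed.

Lemma gap_ge0 F : 0 <= gap F.
Proof.
by have [F' le_gap /settled_gap_ge0 F'0] := settle F; apply: le_trans le_gap.
Qed.

Hypothesis massT : mass x setT = #|V|%:R - 1.

Lemma predV : (#|V|.-1)%:R = #|V|%:R - 1 :> R.
Proof. by rewrite -subn1 natrB // ltnW. Qed.

Lemma rk_graphT : rk_graph setT = #|V|.-1.
Proof.
apply/eqP; rewrite eqn_leq rk_le_pred /=.
by rewrite -(ler_nat R) predV -massT mass_rk.
Qed.

(** Nonnegativity of the gap of the full edge set forces full rank, because [lam > 0]; this is what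
    makes Gao-trees exist. *)
Lemma rk_ladder_graphT : rk_ladder_graph setT = #|V|.-1.
Proof.
apply/eqP; rewrite eqn_leq rk_le_pred /=.
have := gap_ge0 setT; rewrite /gap rk_graphT massT predV -(ler_nat R) predV.
move=> H; rewrite -(ler_pM2l lam_gt0); move: H; lra.
Qed.

Lemma ladder_decomposition : exists n (w : 'I_n -> R) (T T' : 'I_n -> {set E}),
  [/\ forall q, 0 <= w q, \sum_q w q = 1,
      forall q, ladder_tree (T q), forall q, st_tree (T' q)
    & forall e, x e =
        \sum_q w q * (lam * (e \in T q)%:R + (1 - lam) * (e \in T' q)%:R)].
Proof.
pose ok (p : {set E} * {set E}) := ladder_tree p.1 && st_tree p.2.
pose pt (p : {set E} * {set E}) : {ffun E -> R} :=
  [ffun e => lam * (e \in p.1)%:R + (1 - lam) * (e \in p.2)%:R].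
pose ps := [seq p <- enum {: {set E} * {set E}} | ok p].
have sum_in (T : {set E}) : \sum_e (e \in T)%:R = #|T|%:R :> R.
  rewrite -sum1_card natr_sum [RHS]big_mkcond; apply: eq_bigr => e _.
  by case: ifP.
case: (farkas (map pt ps) [ffun e => x e]) => [[c c0 cE]|[w wp wx]].
  have okn (i : 'I_(size ps)) : ok (nth (set0, set0) ps i).
    have := mem_nth (set0, set0) (ltn_ord i).
    by rewrite mem_filter => /andP[].
  have xE e : x e = \sum_(i < size ps) c i * pt (nth (set0, set0) ps i) e.
    have := cE e; rewrite ffunE => ->; rewrite size_map; apply: eq_bigr => i _.
    by rewrite (nth_map (set0, set0)).
  exists (size ps), (fun q => c q), (fun q => (nth (set0, set0) ps q).1),
    (fun q => (nth (set0, set0) ps q).2); split=> // [|i|i|e].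
  (* Farkas' lemma gives a conic combination only. Its coefficients sum to one because [x] and all
     the points [pt p] have the same nonzero coordinate sum [#|V| - 1]. *)
  - have nz : #|V|%:R - 1 != 0 :> R by rewrite -predV pnatr_eq0; lia.
    apply: (mulIf nz); rewrite mul1r -{2}massT.
    have -> : mass x setT = \sum_e x e by apply: eq_bigl => e; rewrite in_setT.
    rewrite (eq_bigr _ (fun e _ => xE e)) exchange_big mulr_suml /=.
    apply: eq_bigr => i _; rewrite -mulr_sumr; congr (_ * _).
    have /andP[/andP[_ /eqP c1] /andP[_ /eqP c2]] := okn i.
    under eq_bigr do rewrite ffunE.
    rewrite big_split /= -!mulr_sumr !sum_in.
    by rewrite c1 c2 predV; lra.
  - by case/andP: (okn i).
  - by case/andP: (okn i).
  - by rewrite xE; apply: eq_bigr => i _; rewrite ffunE.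
(* Against a separating [w], the greedy bases [T] and [T'] for the order of increasing [w] give a
   point [pt (T, T')] with product at least that of [x], a contradiction. *)
pose l := sort [rel e f | w e <= w f] (enum E).
have ul : uniq l by rewrite sort_uniq enum_uniq.
have sl : sorted [rel e f | w e <= w f] l.
  by apply: sort_sorted => e f; apply: le_total.
have lT : [set:: l] = setT by apply/setP => e; rewrite !inE mem_sort mem_enum.
have sum_l (g : E -> R) : \sum_e g e = \sum_(e <- l) g e.
  by rewrite -big_enum; apply: perm_big; rewrite perm_sym perm_sort.
have [T [_ rT cT sufT]] := greedy_basis ladder_pair ul.
have [T' [_ rT' cT' sufT']] := greedy_basis st_pair ul.
have okT : ladder_tree T.
  rewrite /ladder_tree /rk_ladder_graph -rT (eq_conn_rk cT) lT.
  by have := rk_ladder_graphT; rewrite /rk_ladder_graph => ->; rewrite eqxx.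
have okT' : st_tree T'.
  rewrite /st_tree /rk_graph -rT' (eq_conn_rk cT') lT.
  by have := rk_graphT; rewrite /rk_graph => ->; rewrite eqxx.
have /wp : pt (T, T') \in map pt ps.
  by apply: map_f; rewrite mem_filter /ok okT okT' mem_enum.
rewrite leNgt => /negP[]; apply: lt_le_trans wx _.
rewrite -subr_ge0 /dot -sumrB sum_l.
have cnt m (A : {set E}) :
    \sum_(e <- drop m l) (e \in A)%:R = (count [in A] (drop m l))%:R :> R.
  rewrite -sum1_count natr_sum [RHS]big_mkcond; apply: eq_bigr => e _.
  by case: ifP.
(* Both bases meet a suffix in as many edges as its rank, so the suffix sums in Abel's formula are
   gaps. *)
have ptE m : \sum_(e <- drop m l) (pt (T, T') e - x e) = gap [set:: drop m l].
  rewrite sumrB; under eq_bigr do rewrite ffunE.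
  rewrite big_split /= -!mulr_sumr !cnt.
  rewrite sufT sufT' /gap; congr (_ - _); rewrite /mass big_uniq ?drop_uniq //=.
  by apply: eq_bigl => e; rewrite inE.
rewrite (eq_bigr (fun e => w e * (pt (T, T') e - x e))) => [|e _]; last first.
  by rewrite ffunE [in RHS]mulrBr.
apply: abel_sorted => // [m|]; first by rewrite ptE gap_ge0.
rewrite -(drop0 l) ptE drop0 lT /gap rk_ladder_graphT rk_graphT massT predV.
by lra.
Qed.

End Decrease.
End LevelledGraph.

(** * Weights of a chain-point *)

Section ChainWeights.
Variables (R : realFieldType) (V E : finType).
Variables (lev : V -> nat) (K : nat) (s t : E -> V) (x : E -> R) (lam : R).
Hypothesis lev_max : forall v, (lev v <= K)%N.
Hypothesis lev_st : forall e, (lev (s e) <= lev (t e))%N.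
Hypothesis x_ge0 : forall e, 0 <= x e.
Hypothesis lam_le1 : lam <= 1.
Implicit Types (e : E) (m i j : nat) (g h : E -> nat).

(** Natural coefficients reduce each (in)equality between weights to a comparison of coefficients at
    a single edge. *)
Definition wsum g : R := \sum_e x e * (g e)%:R.

Lemma wsumD g h : wsum (fun e => g e + h e)%N = wsum g + wsum h.
Proof.
by rewrite -big_split; apply: eq_bigr => e _; rewrite natrD mulrDr.
Qed.

Lemma wsum_le g h : (forall e, g e <= h e)%N -> wsum g <= wsum h.
Proof. by move=> gh; apply: ler_sum => e _; rewrite ler_wpM2l // ler_nat. Qed.

Lemma massE (F : {set E}) (P : pred E) :
  (forall e, (e \in F) = P e) -> mass x F = wsum P.
Proof.
move=> FP; rewrite /mass big_mkcond; apply: eq_bigr => e _; rewrite FP.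
by case: (P e); rewrite ?mulr1 ?mulr0.
Qed.

(** The index is shifted: [below m] is [V_(m-1)], so [below 0] is empty and [crossing m] is the
    weight of the cut of [V_(m-1)]. *)
Definition below m : {set V} := [set v | lev v < m]%N.

Definition degsum m : R := wsum (fun e => (lev (s e) < m) + (lev (t e) < m))%N.

Definition crossing m : R := wsum (fun e => (lev (s e) < m <= lev (t e))%N).

Hypothesis inner_le : forall U : {set V}, U != set0 ->
  wsum (fun e => (s e \in U) && (t e \in U)) <= #|U|%:R - 1.
Hypothesis sumT : wsum (fun=> 1%N) = #|V|%:R - 1.
Hypothesis band_neq0 : forall i, (i <= K)%N -> band lev i i != set0.
Hypothesis K_gt0 : (0 < K)%N.
Hypothesis crossing1 : crossing 1 = 1.
Hypothesis crossing_le : forall i, (i < K)%N -> crossing i.+1 <= 2 - lam.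
Hypothesis degsum_step : forall i, (0 < i < K)%N ->
  degsum i.+1 - degsum i = 2 * #|band lev i i|%:R.

Lemma card_below i j : (i <= j.+1)%N ->
  (#|below i| + #|band lev i j| = #|below j.+1|)%N.
Proof.
move=> ij; rewrite -cardsUI.
have -> : below i :&: band lev i j = set0.
  by apply/setP => v; rewrite !inE; lia.
rewrite cards0 addn0; congr #|pred_of_set _|.
by apply/setP => v; rewrite !inE; lia.
Qed.

(** For [m = 1], the cut has weight 1 and the total is [#|V| - 1], so the bounds for the edges
    inside [V_0] and inside its complement are both tight. The degree condition on the levels gives
    the induction step. *)
Lemma degsum_below m : (0 < m <= K)%N -> degsum m = 2 * #|below m|%:R - 1.
Proof.
elim: m => [//|[_ _|m IH mK]].
  have B0 : below 1 != set0.
    have /set0Pn[v] := band_neq0 (leq0n K); rewrite inE => v0.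
    by apply/set0Pn; exists v; rewrite inE; lia.
  have B1 : ~: below 1 != set0.
    have /set0Pn[v] := band_neq0 (leqnn K); rewrite inE => vK.
    by apply/set0Pn; exists v; rewrite !inE; lia.
  have := inner_le B0; have := inner_le B1; have := sumT.
  have -> : wsum (fun=> 1%N) =
      wsum (fun e => (s e \in below 1) && (t e \in below 1)) +
      wsum (fun e => (s e \in ~: below 1) && (t e \in ~: below 1)) + crossing 1.
    rewrite -!wsumD; apply: eq_bigr => e _; congr (_ * _%:R).
    by rewrite !inE; have := lev_st e; lia.
  have -> : degsum 1 = wsum (fun e => (s e \in below 1) && (t e \in below 1)) +
      wsum (fun e => (s e \in below 1) && (t e \in below 1)) + crossing 1.
    rewrite -!wsumD; apply: eq_bigr => e _; congr (_ * _%:R).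
    by rewrite !inE; have := lev_st e; lia.
  rewrite crossing1 -(cardsC (below 1)) natrD; lra.
have := degsum_step (i := m.+1) mK; rewrite IH; last by lia.
have := @card_below m.+1 m.+1 (leqnSn _); move=> /(congr1 (fun n => n%:R : R)).
by rewrite natrD; lra.
Qed.

Lemma degsum0 : degsum 0 = 0.
Proof. by apply: big1 => e _; rewrite mulr0. Qed.

Lemma crossing0 : crossing 0 = 0.
Proof. by apply: big1 => e _; rewrite mulr0. Qed.

Lemma degsumT : degsum K.+1 = 2 * #|below K.+1|%:R - 2.
Proof.
have -> : degsum K.+1 = wsum (fun=> 1%N) + wsum (fun=> 1%N).
  rewrite -wsumD; apply: eq_bigr => e _; congr (_ * _%:R).
  by rewrite !ltnS !lev_max.
have -> : below K.+1 = setT by apply/setP => v; rewrite !inE ltnS lev_max.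
by rewrite sumT cardsT; lra.
Qed.

Lemma crossingT : crossing K.+1 = 0.
Proof.
by apply: big1 => e _; rewrite [(_ < lev (t e))%N]ltnNge lev_max andbF mulr0.
Qed.

(** The right-hand side is twice the weight of the edges inside [below m]. *)
Lemma degsum_ge m : (0 < m <= K.+1)%N ->
  2 * #|below m|%:R - 3 + lam <= degsum m - crossing m.
Proof.
case/andP; case: m => // m _; rewrite ltnS leq_eqVlt => /orP[/eqP->|mK].
  by rewrite degsumT crossingT; move: lam_le1; lra.
by have := crossing_le mK; rewrite degsum_below ?mK //; lra.
Qed.

(** The left-hand side is twice the weight of the edges with an end in [below m]. *)
Lemma degsum_le m : (m <= K)%N ->
  degsum m + crossing m <= 2 * #|below m|%:R + 1 - lam.
Proof.
case: m => [_|m mK]; last first.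
  by have := crossing_le mK; rewrite degsum_below ?mK //; lra.
rewrite degsum0 crossing0; have := ler0n R #|below 0|.
by move: lam_le1; lra.
Qed.

(** An edge inside [below j.+1] with no end in [below i] lies inside the band, so the bounds
    [degsum_ge] at [j.+1] and [degsum_le] at [i] can be subtracted and halved. *)
Lemma chain_mass_band i j : (i <= j <= i.+1)%N -> (j <= K)%N ->
  #|band lev i j|%:R - 2 + lam <= mass x (band_edges lev s t i j).
Proof.
move=> ij jK; set P := fun e => (i <= lev (s e))%N && (lev (t e) <= j)%N.
rewrite (@massE _ P) => [|e]; last by rewrite inE.
have le1 : degsum j.+1 <= wsum P + wsum P + crossing j.+1 + degsum i + crossing i.
  rewrite -!wsumD; apply: wsum_le => e; rewrite /P.
  by have := lev_st e; lia.
have iK : (i <= K)%N by lia.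
have := degsum_le iK; have := @degsum_ge j.+1 jK.
have := @card_below i j; rewrite leqW; last by lia.
move/(_ isT)/(congr1 (fun n => n%:R : R)); rewrite natrD.
by lra.
Qed.

Lemma chain_mass_cross i : (i < K)%N ->
  mass x [set e | (lev (s e) <= i < lev (t e))%N] <= 2 - lam.
Proof.
move=> iK; rewrite (@massE _ (fun e => (lev (s e) <= i < lev (t e))%N)).
  exact: crossing_le.
by move=> e; rewrite inE.
Qed.

(** Let [L] be level [i.+1]. Its degree sum [2|L|] is [2x(E(L))] plus the weights of the cuts below
    and above [L], minus twice the weight of the edges skipping [L]. The cuts weigh at most
    [2 - lam] each and [x(E(L)) <= |L| - 1]. *)
Lemma chain_mass_long i : (i < K)%N ->
  mass x [set e | (lev (s e) <= i)%N && (i.+1 < lev (t e))%N] <= 1 - lam.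
Proof.
move=> iK; set P := fun e => (lev (s e) <= i)%N && (i.+1 < lev (t e))%N.
rewrite (@massE _ P) => [|e]; last by rewrite inE.
have [Ki|iK'] := leqP K i.+1.
  rewrite [wsum P]big1 ?subr_ge0 // => e _; rewrite /P.
  by have := lev_max (t e); case: (ltnP i.+1) => *; rewrite ?andbF ?mulr0 //; lia.
have := degsum_step (i := i.+1) iK'.
have := crossing_le iK; have := crossing_le iK'.
pose Q e := (s e \in band lev i.+1 i.+1) && (t e \in band lev i.+1 i.+1).
have : wsum Q <= #|band lev i.+1 i.+1|%:R - 1 by apply/inner_le/band_neq0.
suff: wsum P + wsum P + degsum i.+2 <=
    degsum i.+1 + crossing i.+1 + crossing i.+2 + wsum Q + wsum Q by lra.
rewrite -!wsumD; apply: wsum_le => e; rewrite /P /Q !inE.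
by have := lev_st e; lia.
Qed.

End ChainWeights.

(** * Oriented graphs *)

Lemma orient_ends (G : ugraph) (lev : vertex G -> nat) :
  exists st : edge G -> vertex G * vertex G, forall e,
    ends e = [set (st e).1; (st e).2] /\ (lev (st e).1 <= lev (st e).2)%N.
Proof.
apply: (@fin_all_exists (edge G) (fun=> (vertex G * vertex G)%type)
  (fun e p => ends e = [set p.1; p.2] /\ (lev p.1 <= lev p.2)%N)) => e.
suff [u [v uv]] : exists u v, ends e = [set u; v].
  case: (leqP (lev u) (lev v)) => luv; first by exists (u, v).
  by exists (v, u); rewrite setUC uv; split=> //; apply: ltnW.
have /andP[e0] := ends_card e; rewrite leq_eqVlt ltnS.
case/orP=> [/cards2P[u [v [_ uv]]]|e1]; first by exists u, v.
have /cards1P[u uE] : #|ends e| == 1%N by rewrite eqn_leq e1.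
by exists u, u; rewrite setUid.
Qed.

Section Orientation.
Variables (G : ugraph) (s t : edge G -> vertex G).
Hypothesis endsE : forall e, ends e = [set s e; t e].
Notation V := (vertex G).
Notation E := (edge G).
Implicit Types (e : E) (u v : V) (T F : {set E}) (U : {set V}).

Lemma joinsE e u v :
  joins e u v = (s e == u) && (t e == v) || (s e == v) && (t e == u).
Proof.
rewrite /joins endsE; apply/eqP/idP => [st|]; last first.
  by case/orP=> /andP[/eqP-> /eqP->] //; rewrite setUC.
have : s e \in [set u; v] by rewrite -st !inE eqxx.
have : t e \in [set u; v] by rewrite -st !inE eqxx orbT.
have : u \in [set s e; t e] by rewrite st !inE eqxx.
have : v \in [set s e; t e] by rewrite st !inE eqxx orbT.
rewrite !inE ![v == _]eq_sym ![u == _]eq_sym.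
by do 4!case: eqP => //=.
Qed.

Lemma edges_betweenE (A B : {set V}) e : (e \in edges_between A B) =
  (s e \in A) && (t e \in B) || (t e \in A) && (s e \in B).
Proof.
rewrite inE; apply/existsP/idP => [[u /andP[uA /existsP[v /andP[vB]]]]|].
  rewrite joinsE => /orP[]/andP[/eqP-> /eqP->]; rewrite uA vB ?orbT //.
case/orP=> /andP[eA eB].
  exists (s e); rewrite eA; apply/existsP; exists (t e).
  by rewrite eB joinsE !eqxx.
exists (t e); rewrite eA; apply/existsP; exists (s e).
by rewrite eB joinsE !eqxx orbT.
Qed.

Lemma inner_edgesE U e : (e \in inner_edges U) = (s e \in U) && (t e \in U).
Proof. by rewrite edges_betweenE andbC orbb. Qed.

Lemma cutE U e : (e \in cut U) = (s e \in U) (+) (t e \in U).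
Proof. by rewrite edges_betweenE !inE; do 2!case: (_ \in U). Qed.

Lemma connect_adj T u v : connect (adj T) u v = conn (st_pair s t @: T) u v.
Proof.
apply: eq_connect => a b; apply/existsP/orP => [[e /andP[Te]]|].
  rewrite joinsE => /orP[]/andP[/eqP<- /eqP<-]; [left|right];
  by apply/st_pairP; exists e.
case=> /st_pairP[e Te [-> ->]]; exists e; rewrite Te joinsE !eqxx ?orbT //.
Qed.

Lemma conn_walk T (p q : V * E) (c : seq (V * E)) :
  path [rel p q | joins p.2 p.1 q.1] q (rcons c p) ->
  all [in T] (unzip2 (q :: c)) -> conn (st_pair s t @: T) q.1 p.1.
Proof.
have conn_joins e u v : e \in T -> joins e u v -> conn (st_pair s t @: T) u v.
  move=> Te; rewrite joinsE => /orP[]/andP[/eqP<- /eqP<-]; first exact: conn_edge.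
  by rewrite conn_sym conn_edge.
elim: c q => [|r c IH] q /=.
  by rewrite !andbT => qp qT; apply: conn_joins qp.
case/andP=> qr rp /andP[qT cT]; apply: conn_trans (IH r rp cT).
exact: conn_joins qr.
Qed.

(** The rest of the circuit avoids [e], its edges being distinct, and leads from one end of [e] to
    the other; for a loop the rest is empty. *)
Lemma circuit_conn T v e (c : seq (V * E)) :
  circuit ((v, e) :: c) -> all [in T] (unzip2 ((v, e) :: c)) ->
  conn (st_pair s t @: (T :\ e)) (s e) (t e).
Proof.
case/and4P=> _ _ /= /andP[ec uc] cyc /andP[eT cT].
suff [w wv ew] : exists2 w, conn (st_pair s t @: (T :\ e)) w v & joins e v w.
  move: ew; rewrite joinsE => /orP[]/andP[/eqP-> /eqP->] //.
  by rewrite conn_sym.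
case: c ec uc cyc cT => [|q c] ec _ /=.
  by rewrite andbT => ev _; exists v => //; apply: conn_refl.
case/andP=> vq cyc cT; exists q.1 => //.
apply: (conn_walk cyc); apply/allP => f fc; rewrite !inE.
have {}cT : all [in T] (unzip2 (q :: c)) by [].
rewrite (allP cT f fc) andbT.
by apply: contraNneq ec => <-.
Qed.

(** An edge of a circuit could be removed without lowering the rank, which would then be less than
    [#|T|]. *)
Lemma st_tree_spanning T : st_tree s t T -> spanning_tree T.
Proof.
case/andP=> /eqP rT /eqP cT; split=> [u v|c cc].
  by rewrite connect_adj rk_conn // -/(rk_graph s t T) rT.
case: c cc => [|[v e] c] cc; first by case/andP: cc.
apply/negP => allT; have eT : e \in T by case/andP: allT.
have : (rk_graph s t T <= rk_graph s t (T :\ e))%N.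
  apply: rk_incl => a b /st_pairP[f Tf [-> ->]].
  have [->|fe] := eqVneq f e; first exact: circuit_conn cc allT.
  by apply: conn_edge; rewrite !inE fe.
have : (rk_graph s t (T :\ e) <= #|T :\ e|)%N.
  exact: leq_trans (rk_card _) (leq_imset_card _ _).
move=> h1 h2; have := leq_trans h2 h1; rewrite rT -cT (cardsD1 e T) eT.
by rewrite add1n ltnn.
Qed.

(** Submodularity splits the rank of the independent set [T] between the edges inside [U] and the
    others, so the former are independent and number at most the rank of [setX U U]. *)
Lemma st_tree_inner T U : st_tree s t T -> U != set0 ->
  (#|T :&: inner_edges U| < #|U|)%N.
Proof.
case/andP=> /eqP rT /eqP cT U0; set I := inner_edges U.
have rD : (rk_graph s t (T :\: I) <= #|T :\: I|)%N.
  exact: leq_trans (rk_card _) (leq_imset_card _ _).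
have rI : (rk_graph s t (T :&: I) <= rk (setX U U))%N.
  apply/rk_sub/subsetP => z /imsetP[e]; rewrite in_setI inner_edgesE.
  by case/andP=> _ eU ->; rewrite in_setX.
have := rk_submod (st_pair s t @: (T :&: I)) (st_pair s t @: (T :\: I)).
rewrite -imsetU setID -!/(rk_graph s t _) rT -cT -(cardsID I T) => sub.
apply: leq_ltn_trans (rk_box U0); apply: leq_trans rI.
move: rD (leq_trans (leq_addr _ _) sub).
move: #|T :&: I| #|T :\: I| (rk_graph _ _ _) (rk_graph _ _ _) => *; lia.
Qed.

(** * The spanning tree polytope, rank bounds and averages of trees *)

Section Polytope.
Variable R : realType.
Implicit Type x : {ffun E -> R}.

(** The rank of [F] is the sum of [#|U| - 1] over its components [U]. Each edge of [F] lies inside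
    one component, and the polytope bounds the mass inside [U] by [#|U| - 1]. *)
Lemma polytope_mass_rk x F :
  spanning_tree_polytope x -> mass x F <= (rk_graph s t F)%:R.
Proof.
case=> x0 xU _; set P := st_pair s t @: F.
rewrite /rk_graph /rk -/P natrB ?card_components // -(sum_card_components P).
rewrite -sum1_card !natr_sum -sumrB /mass.
rewrite (partition_big (fun e => component P (s e)) [in components P])
  => [|e _]; last exact: imset_f.
apply: ler_sum => U /imsetP[a _ ->].
apply: le_trans (xU _ _); last by apply/set0Pn; exists a; rewrite inE conn_refl.
pose A := [set e in F | component P (s e) == component P a].
rewrite /Defs.total [leRHS](bigID [in A]) /=.
rewrite -[leLHS]addr0 lerD ?sumr_ge0 // le_eqVlt; apply/orP; left; apply/eqP.
apply: eq_bigl => e; rewrite inner_edgesE !inE component_eq.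
case: (boolP (e \in F)) => [Fe|_]; last by rewrite andbF.
case: (boolP (conn P (s e) a)) => [sa|_]; last by rewrite /= andbF.
rewrite conn_sym sa !andbT; symmetry; apply/idP.
by apply: conn_trans (conn_edge s t Fe); rewrite conn_sym.
Qed.

Lemma polytope_trees n (w : 'I_n -> R) (T : 'I_n -> {set E}) :
  (0 < #|V|)%N -> (forall i, 0 <= w i) -> \sum_i w i = 1 ->
  (forall i, st_tree s t (T i)) ->
  spanning_tree_polytope [ffun e => \sum_i w i * (e \in T i)%:R].
Proof.
move=> V0 w0 w1 okT.
have totalE F : Defs.total [ffun e => \sum_i w i * (e \in T i)%:R] F =
    \sum_i w i * #|T i :&: F|%:R.
  rewrite /Defs.total; under eq_bigr do rewrite ffunE.
  rewrite exchange_big; apply: eq_bigr => i _; rewrite -mulr_sumr; congr (_ * _).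
  rewrite -sum1_card natr_sum big_mkcond [RHS]big_mkcond; apply: eq_bigr => e _.
  by rewrite inE andbC; do 2!case: (_ \in _).
have avg (c : R) : c = \sum_i w i * c by rewrite -mulr_suml w1 mul1r.
split=> [e|U U0|].
- by rewrite ffunE sumr_ge0 // => i _; rewrite mulr_ge0 // ler0n.
- rewrite totalE (avg (_ - 1)); apply: ler_sum => i _; rewrite ler_wpM2l //.
  by rewrite lerBrDr natr1 ler_nat st_tree_inner.
- rewrite totalE (avg (_ - 1)); apply: eq_bigr => i _; rewrite setIT.
  by have /andP[_ /eqP ->] := okT i; rewrite -subn1 natrB.
Qed.

End Polytope.
End Orientation.

(** * The chain *)

Section ChainLevel.
Variables (G : ugraph) (k : nat) (C : 'I_k.+1 -> {set vertex G}).
Hypothesis chainC : is_chain C.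
Implicit Types (v : vertex G) (i j : 'I_k.+1).

(** A vertex outside [V_k] gets the value [k.+1], the length of the list, which is its right
    level. *)
Definition chain_level v : nat :=
  find (fun m => v \in C (inord m)) (iota 0 k.+1).

Lemma chain_sub i j : (i <= j)%N -> C i \subset C j.
Proof.
rewrite leq_eqVlt => /orP[/eqP/val_inj->//|ij].
by have [_ /(_ _ _ ij)/proper_sub] := chainC.
Qed.

Lemma mem_chain i v : (v \in C i) = (chain_level v <= i)%N.
Proof.
apply/idP/idP => [vi|vi].
  rewrite leqNgt; apply/negP => /(before_find 0%N).
  by rewrite nth_iota // add0n inord_val vi.
have lt_k : (chain_level v < k.+1)%N by apply: leq_ltn_trans vi (ltn_ord i).
have hasv : has (fun m => v \in C (inord m)) (iota 0 k.+1).
  by rewrite has_find size_iota.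
have := nth_find 0%N hasv; rewrite nth_iota // add0n.
by apply/subsetP/chain_sub; rewrite inordK.
Qed.

Lemma chain_level_le v : (chain_level v <= k.+1)%N.
Proof. by rewrite -[leqRHS](size_iota 0) find_size. Qed.

Lemma chain_level_ex m : (m <= k.+1)%N -> exists v, chain_level v = m.
Proof.
have [C0 Cp Cmax] := chainC; rewrite leq_eqVlt => /orP[/eqP->|mk].
  have [_ [v _]] := properP Cmax; rewrite mem_chain -ltnNge /= => kv.
  by exists v; apply/eqP; rewrite eqn_leq chain_level_le.
case: m mk => [_|m mk].
  have [v] := set0Pn _ C0; rewrite mem_chain leqn0 => /eqP v0.
  by exists v.
have mk' : (m < k.+1)%N by apply: ltnW.
have /properP[_ [v]] := Cp (Ordinal mk') (Ordinal mk) (ltnSn m).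
rewrite !mem_chain /= -ltnNge => v1 v2; exists v.
by apply/eqP; rewrite eqn_leq v1.
Qed.

Lemma mem_level i v : (v \in level C i) = (chain_level v == i).
Proof.
rewrite inE mem_chain; case: i => [[|m] mk] /=; first by rewrite inE leqn0.
by rewrite mem_chain inordK ?(ltnW mk) // -ltnNge eqn_leq andbC.
Qed.

End ChainLevel.

(** * Cuts and degrees of the chain in terms of levels *)

Section MainProof.
Variables (R : realType) (G : ugraph) (k : nat).
Variables (C : 'I_k.+1 -> {set vertex G}) (x : {ffun edge G -> R}).
Variables s t : edge G -> vertex G.
Hypothesis chainC : is_chain C.
Hypothesis endsE : forall e, ends e = [set s e; t e].
Notation lev := (chain_level C).
Hypothesis lev_st : forall e, (lev (s e) <= lev (t e))%N.

Lemma total_wsum (F : {set edge G}) (P : pred (edge G)) :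
  (forall e, (e \in F) = P e) -> Defs.total x F = wsum x P.
Proof. exact: massE. Qed.

Lemma mem_chain_cut i e :
  (e \in cut (C i)) = (lev (s e) <= i < lev (t e))%N.
Proof. by rewrite (cutE endsE) !mem_chain //; have := lev_st e; lia. Qed.

Lemma total_chain_cut i : Defs.total x (cut (C i)) = crossing lev s t x i.+1.
Proof. by apply: total_wsum => e; rewrite mem_chain_cut. Qed.

(** Stars omit loops while the right-hand side counts them twice; the polytope constraint for a
    singleton gives loops weight zero. *)
Lemma sum_star (W : {set vertex G}) : spanning_tree_polytope x ->
  \sum_(v in W) Defs.total x (star v) =
  wsum x (fun e => (s e \in W) + (t e \in W))%N.
Proof.
case=> x0 xU _.
have loop0 e : s e = t e -> x e = 0.
  move=> st; apply/eqP; rewrite eq_le x0 andbT.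
  have s0 : [set s e] != set0 by apply/set0Pn; exists (s e); rewrite inE.
  have := xU _ s0; rewrite cards1 subrr; apply: le_trans.
  rewrite /Defs.total (bigD1 e) /=; last first.
    by rewrite (inner_edgesE endsE) -st set11.
  by rewrite lerDl sumr_ge0.
under eq_bigr => v _.
  rewrite (@total_wsum _ (fun e => (s e == v) (+) (t e == v))); last first.
    by move=> e; rewrite (cutE endsE) !inE.
  over.
rewrite exchange_big; apply: eq_bigr => e _ /=; rewrite -mulr_sumr.
have [st|st] := eqVneq (s e) (t e); first by rewrite loop0 // !mul0r.
congr (_ * _); rewrite -natr_sum; congr (_%:R).
have cnt u : (\sum_(v in W) (u == v) = (u \in W))%N.
  have [uW|uW] := boolP (u \in W).
    rewrite (bigD1 u) //= eqxx big1 ?addn0 // => v /andP[_ vu].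
    by rewrite eq_sym (negPf vu).
  by rewrite big1 // => v vW; case: eqP uW => // ->; rewrite vW.
rewrite -!cnt -big_split; apply: eq_bigr => v _ /=.
have : ~~ ((s e == v) && (t e == v)) by apply: contra st => /andP[/eqP-> /eqP->].
by do 2!case: (_ == v).
Qed.

End MainProof.

Theorem theorem3 (R : realType) (G : ugraph) (k : nat)
    (C : 'I_k.+1 -> {set vertex G}) (x : {ffun edge G -> R})
    (lambda : R) :
  is_chain C ->
  chain_point C x ->
  lambda = 2 - max_cut C x ->
  exists y x' : {ffun edge G -> R},
    [/\ gao_polytope C y,
        spanning_tree_polytope x'
      & x = [ffun e => lambda * y e + (1 - lambda) * x' e]].
Proof.
move=> chainC [spx cut0 cutk cut_lt deg_level] lamE.
have cut_le i : Defs.total x (cut (C i)) <= 2 - lambda.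
  rewrite lamE subKr /max_cut.
  apply: (le_bigmax_seq _ i xpredT (fun j => Defs.total x (cut (C j)))) => //.
  exact: mem_index_enum.
have lam_le1 : lambda <= 1 by have := cut_le ord0; rewrite cut0; lra.
have lam_gt0 : 0 < lambda.
  rewrite lamE subr_gt0; apply: bigmax_lt => [|i _]; first by rewrite cut0; lra.
  have [->|i0] := eqVneq i ord0; first by rewrite cut0; lra.
  have [->|ik] := eqVneq i ord_max; first by rewrite cutk; lra.
  apply: cut_lt; move: i0 ik; rewrite -!val_eqE /=; have := ltn_ord i; lia.
have [st stE] := orient_ends (chain_level C).
pose s e := (st e).1; pose t e := (st e).2.
have endsE e : ends e = [set s e; t e] by case: (stE e).
have lev_st e : (chain_level C (s e) <= chain_level C (t e))%N by case: (stE e).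
have lev_max := chain_level_le C.
have [v0 _] := chain_level_ex chainC (leq0n _).
(* The default [v0] is not reached for [m <= k.+1], as every level is inhabited. *)
pose rep m := odflt v0 [pick v | chain_level C v == m].
have lev_rep m : (m <= k.+1)%N -> chain_level C (rep m) = m.
  move=> mk; rewrite /rep; case: pickP => [v /eqP//|nov].
  by have [v /eqP] := chain_level_ex chainC mk; rewrite nov.
have V_gt1 : (1 < #|vertex G|)%N.
  have : rep 0 != rep k.+1.
    by apply: contraTneq isT => /(congr1 (chain_level C)); rewrite !lev_rep.
  move=> neq; rewrite -[ltnRHS]cardsT.
  by apply/card_gt1P; exists (rep 0), (rep k.+1).
have [x0 xU xT] := spx.
have inner_le (U : {set vertex G}) : U != set0 ->
    wsum x (fun e => (s e \in U) && (t e \in U)) <= #|U|%:R - 1.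
  move/xU; apply: le_trans; rewrite le_eqVlt; apply/orP; left; apply/eqP.
  by symmetry; apply: total_wsum => e; rewrite (inner_edgesE endsE).
have sumT : wsum x (fun=> 1%N) = #|vertex G|%:R - 1.
  by rewrite -xT; symmetry; apply: (@total_wsum _ _ _ _ xpredT) => e; rewrite inE.
have band_neq0 i : (i <= k.+1)%N -> band (chain_level C) i i != set0.
  by move=> ik; apply/set0Pn; exists (rep i); rewrite inE lev_rep // leqnn.
have cutE i : Defs.total x (cut (C i)) = crossing (chain_level C) s t x i.+1.
  exact: total_chain_cut.
have crossing1 : crossing (chain_level C) s t x 1 = 1 by rewrite -cut0 cutE.
have crossing_le i : (i < k.+1)%N ->
    crossing (chain_level C) s t x i.+1 <= 2 - lambda.
  by move=> ik; have := cut_le (Ordinal ik); rewrite cutE.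
have degsum_step i : (0 < i < k.+1)%N ->
    degsum (chain_level C) s t x i.+1 - degsum (chain_level C) s t x i =
    2 * #|band (chain_level C) i i|%:R.
  case/andP=> i0 ik; have := deg_level (Ordinal ik) i0.
  have -> : level C (Ordinal ik) = band (chain_level C) i i.
    by apply/setP => v; rewrite mem_level // inE -eqn_leq eq_sym.
  move=> <-; rewrite (sum_star endsE) //; apply/eqP; rewrite subr_eq -wsumD.
  apply/eqP; apply: eq_bigr => e _; congr (_ * _%:R); rewrite !inE.
  by lia.
have mass_rk F : mass x F <= (rk_graph s t F)%:R by apply: polytope_mass_rk.
have massT : mass x setT = #|vertex G|%:R - 1 by rewrite -xT.
have [n [w [T [T' [w0 w1 okT okT' xE]]]]] :=
  ladder_decomposition lev_max lev_st lev_rep V_gt1 x0 lam_gt0 lam_le1 mass_rk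
    (chain_mass_band lev_max lev_st x0 lam_le1 inner_le sumT band_neq0
       (ltn0Sn k) crossing1 crossing_le degsum_step)
    (chain_mass_cross crossing_le)
    (chain_mass_long lev_max lev_st x0 lam_le1 inner_le band_neq0
       (ltn0Sn k) crossing_le degsum_step) massT.
(* The same weights serve twice: [y] averages the Gao-trees [T i] and [x'] the spanning trees
   [T' i]. *)
exists [ffun e => \sum_i w i * (e \in T i)%:R],
  [ffun e => \sum_i w i * (e \in T' i)%:R]; split.
- exists n, w, (fun i => incidence R (T i)); split=> // [i|].
    exists (T i) => //; split.
      exact/(st_tree_spanning endsE)/(ladder_tree_st lev_max lev_st lev_rep).
    move=> j.
    rewrite -(ladder_tree_cut lev_max lev_rep V_gt1 (okT i) (ltn_ord j)).
    congr #|pred_of_set _|; apply/setP => e.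
    by rewrite [RHS]inE in_setI (mem_chain_cut chainC endsE lev_st).
  by apply/ffunP => e; rewrite !ffunE; apply: eq_bigr => i _; rewrite ffunE.
- by apply: (polytope_trees endsE) => //; apply: ltnW.
- apply/ffunP => e; rewrite xE !ffunE !mulr_sumr -big_split.
  by apply: eq_bigr => i _ /=; ring.
Qed.
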